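(* Let $F$ be a graph and $k \geq 1$. Then the function $\mathrm{sub}(F,\cdot)$ is $k$-WL invariant if and only if the hereditary tree-width of $F$ satisfies $\mathrm{htw}(F) \leq k$.
   Context: All graphs are finite, simple and undirected. For graphs $F,G$, $\mathrm{sub}(F,G)$ denotes the number of subgraphs of $G$ isomorphic to $F$. A graph $H$ is a homomorphic image of $F$ if there is a surjective map $\varphi\colon V(F)\to V(H)$ that is a homomorphism (edges map to edges) and satisfies $E(H)=\{\varphi(v)\varphi(w) \mid vw\in E(F)\}$. The hereditary tree-width $\mathrm{htw}(F)$ is the maximum tree-width of a homomorphic image of $F$. The $k$-dimensional Weisfeiler-Leman algorithm ($k$-WL): for a graph $G$, the initial coloring $\chi^{(0)}_G$ of $V(G)^k$ assigns to $(v_1,\dots,v_k)$ its ordered isomorphism type, i.e. $\chi^{(0)}_G(v_1,\dots,v_k)=\chi^{(0)}_G(v_1',\dots,v_k')$ iff for all $i,j\in[k]$: $v_i=v_j\Leftrightarrow v_i'=v_j'$ and $v_iv_j\in E(G)\Leftrightarrow v_i'v_j'\in E(G)$. For $k\geq 2$ and $\bar v=(v_1,\dots,v_k)$, set $\chi^{(i+1)}_G(\bar v)=\big(\chi^{(i)}_G(\bar v),\ \{\!\{(\chi^{(i)}_G(\bar v[w/1]),\dots,\chi^{(i)}_G(\bar v[w/k])) \mid w\in V(G)\}\!\}\big)$, where $\bar v[w/j]$ is $\bar v$ with its $j$-th entry replaced by $w$ and $\{\!\{\cdot\}\!\}$ denotes a multiset. For $k=1$, $\chi^{(i+1)}_G(v_1)=\big(\chi^{(i)}_G(v_1),\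 \{\!\{\chi^{(i)}_G(w)\mid w\in N_G(v_1)\}\!\}\big)$. The colorings are computed with a common (graph-independent) encoding of colors, and the stable coloring $\chi_G$ is $\chi^{(i)}_G$ for the least $i$ at which the partition into color classes no longer refines. $k$-WL distinguishes $G$ and $H$ if some color $c$ occurs a different number of times in $\chi_G$ on $V(G)^k$ than in $\chi_H$ on $V(H)^k$; write $G\simeq_k H$ otherwise. The function $\mathrm{sub}(F,\cdot)$ is $k$-WL invariant if $\mathrm{sub}(F,G)=\mathrm{sub}(F,H)$ for all graphs $G,H$ with $G\simeq_k H$. *)

(* Defs.v *)
From mathcomp Require Import all_boot.
From mathcomp Require Import finmap multiset boolp.

Set Implicit Arguments.
Unset Strict Implicit.
Unset Printing Implicit Defensive.

Record sgraph := SGraph {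
  svertex :> finType;
  sedge : rel svertex;
  sedge_sym : symmetric sedge;
  sedge_irr : irreflexive sedge }.

Notation "x -- y" := (sedge x y) (at level 30).

Definition sg_iso (F G : sgraph) : bool :=
  [exists f : {ffun F -> G}, [&& injectiveb f, [forall y, y \in codom f]
    & [forall x, [forall y, (f x -- f y) == (x -- y)]]]].

(** Subgraphs are pairs (S, D) of a vertex set and an edge set. *)

Definition edges (G : sgraph) : {set {set G}} :=
  [set e | [exists x, [exists y, (x -- y) && (e == [set x; y])]]].

Definition is_subgraph (G : sgraph) (P : {set G} * {set {set G}}) : bool :=
  (P.2 \subset edges G) && [forall e in P.2, e \subset P.1].

Section SubgraphAsGraph.
Variables (G : sgraph) (P : {set G} * {set {set G}}).

Definition subgraph_rel : rel {x : G | x \in P.1} :=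
  fun x y => (val x -- val y) && ([set val x; val y] \in P.2).

Lemma subgraph_rel_sym : symmetric subgraph_rel.
Proof. by move=> x y; rewrite /subgraph_rel sedge_sym setUC. Qed.

Lemma subgraph_rel_irr : irreflexive subgraph_rel.
Proof. by move=> x; rewrite /subgraph_rel sedge_irr. Qed.

Definition subgraph_sgraph : sgraph := SGraph subgraph_rel_sym subgraph_rel_irr.
End SubgraphAsGraph.

Definition sub (F G : sgraph) : nat :=
  #|[set P : {set G} * {set {set G}}
       | is_subgraph P && sg_iso F (subgraph_sgraph P)]|.

Definition hom_image (F H : sgraph) : Prop :=
  exists f : F -> H,
    [/\ forall x : H, exists v : F, f v = x,
        forall v w : F, v -- w -> f v -- f w
      & forall x y : H, x -- y ->
          exists v w : F, [/\ v -- w, f v = x & f w = y]].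

Definition is_tree (T : sgraph) : Prop :=
  [/\ 0 < #|T|,
      forall s t : T, connect (@sedge T) s t
    & forall c : seq T, ucycle (@sedge T) c -> size c <= 2].

Definition tree_decomposition (G T : sgraph) (B : T -> {set G}) : Prop :=
  [/\ is_tree T,
      forall v w : G, v -- w -> exists t : T, (v \in B t) && (w \in B t),
      forall v : G, exists t : T, v \in B t
    & forall (v : G) (s t : T), v \in B s -> v \in B t ->
        connect [rel a b : T | [&& a -- b, v \in B a & v \in B b]] s t].

(** The predecessor is truncated: the empty graph gets width 0, not -1. *)
Definition width (G T : sgraph) (B : T -> {set G}) : nat :=
  (\max_(t : T) #|B t|).-1.

Definition has_decomposition (G : sgraph) : pred nat := fun w =>
  `[< exists (T : sgraph) (B : T -> {set G}),
        tree_decomposition B /\ width B = w >].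

Section TrivialDecomposition.

Lemma unit_rel_sym : symmetric (fun _ _ : unit => false). Proof. by []. Qed.
Lemma unit_rel_irr : irreflexive (fun _ : unit => fun _ : unit => false).
Proof. by []. Qed.

Lemma has_decomposition_trivial (G : sgraph) : has_decomposition G #|G|.-1.
Proof.
apply/asboolP; exists (SGraph unit_rel_sym unit_rel_irr), (fun=> [set: G]).
split; last first.
  rewrite /width (eq_bigr (fun=> #|G|)) => [|t _]; last by rewrite cardsT.
  by rewrite big_const card_unit /= maxn0.
split=> [|v w _|v|v [] [] _ _]; last exact: connect0.
- split=> [|[] []|]; [by rewrite card_unit | exact: connect0 |].
  by case=> [//|x [//|y c]] /andP[].
- by exists tt; rewrite !inE.
- by exists tt; rewrite inE.
Qed.

Lemma ex_decomposition (G : sgraph) : exists w, has_decomposition G w.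
Proof. by exists #|G|.-1; apply: has_decomposition_trivial. Qed.

End TrivialDecomposition.

Definition treewidth (G : sgraph) : nat := ex_minn (ex_decomposition G).

Definition image_treewidth (F : sgraph) : pred nat := fun w =>
  `[< exists H : sgraph, hom_image F H /\ treewidth H = w >].

Lemma ex_image_treewidth (F : sgraph) : exists w, image_treewidth F w.
Proof.
exists (treewidth F); apply/asboolP; exists F; split=> //.
exists id; split=> // [x|x y xy]; first by exists x.
by exists x, y.
Qed.

Lemma image_treewidth_bound (F : sgraph) (w : nat) :
  image_treewidth F w -> w <= #|F|.
Proof.
move=> /asboolP[H [[f [fsurj _ _]] <-]].
have le_tw : treewidth H <= #|H|.-1.
  rewrite /treewidth; case: ex_minnP => m _; apply.
  exact: has_decomposition_trivial.
apply: leq_trans le_tw (leq_trans (leq_pred _) _).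
rewrite -[#|H|](_ : #|codom f| = _) ?leq_image_card //.
by apply: eq_card => x; apply/codomP; have [v <-] := fsurj x; exists v.
Qed.

Definition htw (F : sgraph) : nat :=
  ex_maxn (ex_image_treewidth F) (@image_treewidth_bound F).

(** [wl_color k i] is the graph-independent type of colors of round [i]. *)
Fixpoint wl_color (k i : nat) : choiceType :=
  if i is i'.+1 then
    (wl_color k i' * multiset {ffun 'I_k -> wl_color k i'})%type : choiceType
  else {ffun 'I_k * 'I_k -> bool * bool} : choiceType.

Definition subst_at (k : nat) (V : finType) (v : {ffun 'I_k -> V})
    (j : 'I_k) (w : V) : {ffun 'I_k -> V} :=
  [ffun i => if i == j then w else v i].

(** For k = 1 the multiset ranges over the neighbors of v_1 only; its members,
    the colors of v[w/1] = (w), are then wrapped as functions on 'I_1. *)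
Definition wl_range (k : nat) (G : sgraph) (v : {ffun 'I_k -> G}) : seq G :=
  [seq w <- enum G | (k == 1) ==> [forall i : 'I_k, v i -- w]].

Fixpoint wl (k : nat) (G : sgraph) (i : nat) :
    {ffun 'I_k -> G} -> wl_color k i :=
  match i return {ffun 'I_k -> G} -> wl_color k i with
  | 0 => fun v => [ffun ab => (v ab.1 == v ab.2, v ab.1 -- v ab.2)]
  | i'.+1 => fun v =>
      (wl i' v, seq_mset [seq [ffun j : 'I_k => wl i' (subst_at v j w)]
                              | w <- wl_range v])
  end.

(** Round [i] leaves the partition produced by the previous round unchanged. *)
Definition wl_stalls (k : nat) (G : sgraph) : pred nat := fun i =>
  (0 < i) && [forall v : {ffun 'I_k -> G}, [forall v' : {ffun 'I_k -> G},
    (wl i v == wl i v') == (wl i.-1 v == wl i.-1 v')]].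

Lemma ex_wl_stalls (k : nat) (G : sgraph) : exists i, wl_stalls k G i.
Proof.
pose E i := [set p : {ffun 'I_k -> G} * {ffun 'I_k -> G}
               | wl i p.1 == wl i p.2].
have subE i : E i.+1 \subset E i.
  by apply/subsetP=> p; rewrite !inE => /eqP/(congr1 fst)/= ->.
have [i eqE] : exists i, E i.+1 = E i.
  apply/not_existsP => neqE.
  have ltE i : #|E i.+1| < #|E i|.
    by apply: proper_card; rewrite properEneq subE andbT; apply/eqP/neqE.
  have le0 i : #|E i| + i <= #|E 0|.
    elim: i => [|i]; first by rewrite addn0.
    by apply: leq_trans; rewrite addnS -addSn leq_add2r.
  by have := leq_trans (leq_addl _ _) (le0 #|E 0|.+1); rewrite ltnn.
exists i.+1; apply/andP; split=> //; apply/forallP=> v; apply/forallP=> v'.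
by move/setP/(_ (v, v')): eqE; rewrite !inE /= => ->.
Qed.

(** The stable round is the least round that does not refine the preceding
    partition (not the round before it): on a regular graph the partition of
    V^1 is trivial from round 0 on, but the degree enters the colors only at
    round 1, and stable colors are compared between graphs. *)
Definition wl_stable_round (k : nat) (G : sgraph) : nat :=
  ex_minn (ex_wl_stalls k G).

Definition wl_stable (k : nat) (G : sgraph) (v : {ffun 'I_k -> G}) :
    {i : nat & wl_color k i} :=
  Tagged (wl_color k) (wl (wl_stable_round k G) v).

Definition wl_count (k : nat) (G : sgraph) (c : {i : nat & wl_color k i}) :
    nat :=
  #|[set v : {ffun 'I_k -> G} | wl_stable v == c]|.

Definition wl_distinguishes (k : nat) (G H : sgraph) : Prop :=
  exists c : {i : nat & wl_color k i}, wl_count G c <> wl_count H c.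

Definition wl_equiv (k : nat) (G H : sgraph) : Prop :=
  ~ wl_distinguishes k G H.

Definition wl_invariant (k : nat) (f : sgraph -> nat) : Prop :=
  forall G H : sgraph, wl_equiv k G H -> f G = f H.

(* Main.v *)
(** The k-WL equivalence of two graphs amounts to a winning position for
    Duplicator in the bijective (k+1)-pebble game.  If F has tree-width at most
    k, replaying Duplicator's bijections along a tree decomposition of F injects
    the homomorphisms from F to G into those from F to G'.  Sorting
    homomorphisms by their kernel expresses the number of embeddings of F, hence
    sub(F, G), through homomorphism counts of homomorphic images of F, so
    htw(F) <= k gives invariance.

    Conversely let H be a homomorphic image of F with tree-width above k.  By
    tree-width duality H carries a haven, by which Duplicator wins on the
    Cai-Fuerer-Immerman graphs X0 (untwisted) and X1 (twisted once) over H, and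
    on their induced subgraphs over subsets of V(H) with every vertex cloned t
    times.  The number of embeddings of F into such a cloned graph is a
    polynomial in t.  Keeping, by inclusion-exclusion over the subsets of V(H),
    only the maps F -> Xi that are onto V(H), the coefficient of t^|V(H)| sums,
    with a common sign, positive weights over the maps whose image has one
    vertex over each vertex of H.  For a given map F -> H there are at least as
    many such lifts to X0 as to X1, and if the map is also onto E(H) there are
    some to X0 but none to X1, by parity.  So sub(F, .) distinguishes two
    k-WL equivalent graphs. *)

Require Import Defs.
From mathcomp Require Import all_boot.
From mathcomp Require Import all_order all_algebra finmap multiset boolp.

Set Implicit Arguments.
Unset Strict Implicit.
Unset Printing Implicit Defensive.

(** * The bijective pebble game *)

(** The obstacle in the converse is cancellation: sub(F, .) combines homomorphism counts of all
    images of F with coefficients of both signs, so other images could undo the difference caused by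
    H. Cloning prevents this. The embeddings over a fixed map f from F to Xi are counted by a
    product of falling factorials in t, one per fiber of f. Its lowest power is t^d, where d is the
    number of image points, and the coefficient there has sign (-1)^(|F|-d). A map onto V(H) has d
    >= |V(H)|, so t^|V(H)| sees only maps with one image point over each vertex of H, all with the
    same sign. Maps not onto V(H) could reach this power too, which is why they are removed
    beforehand. For the haven, components must be chosen coherently for all sets of at most k+1
    vertices. They come from a family of pairwise intersecting edge sets. Trees of partitions of the
    edge set are used because the border is submodular: trees for the complements of two disjoint
    sets can be restricted to complementary sides and glued. *)

Lemma perm_map_lift (A B C : eqType) (K : A -> C) (K' : B -> C) s s' :
  perm_eq (map K s) (map K' s') ->
  exists2 t : seq B, perm_eq t s' & map K s = map K' t.
Proof.
elim: s s' => [|x s IHs] s' /= pKs.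
  by exists [::] => //; move/perm_size: pKs; case: s'.
have /mapP[y ys' Kxy] : K x \in map K' s' by rewrite -(perm_mem pKs) mem_head.
have [|t pt Kt] := IHs (rem y s').
  rewrite -(perm_cons (K x)) (permPl pKs) Kxy -map_cons.
  by apply: perm_map; apply: perm_to_rem.
exists (y :: t); last by rewrite /= Kt Kxy.
by rewrite perm_sym (permPl (perm_to_rem ys')) perm_cons perm_sym.
Qed.

(** Passes from a multiset of colors to one of any data that the colors determine across the two
    lists. *)
Lemma perm_map_refine (A B C D : eqType) (K : A -> C) (K' : B -> C)
    (L : A -> D) (L' : B -> D) s s' :
  (forall x y, x \in s -> y \in s' -> K x = K' y -> L x = L' y) ->
  perm_eq (map K s) (map K' s') -> perm_eq (map L s) (map L' s').
Proof.
move=> KL /perm_map_lift[t pt Kt].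
suff -> : map L s = map L' t by apply: perm_map.
have {}KL x y : x \in s -> y \in t -> K x = K' y -> L x = L' y.
  by move=> xs yt; apply: KL; rewrite // -(perm_mem pt).
elim: s t Kt KL {pt} => [|x s IHs] [|y t] //= [Kxy Kst] KL.
rewrite (KL x y) ?mem_head // (IHs t) // => x' y' xs yt.
by apply: KL; rewrite in_cons ?xs ?yt orbT.
Qed.

Lemma count_mem_map_enum (A : finType) (C : eqType) (K : A -> C) c :
  count_mem c (map K (enum A)) = #|[set x | K x == c]|.
Proof.
rewrite count_map cardE -size_filter /enum_mem -filter_predI; congr size.
by apply: eq_filter => x; rewrite !inE andbT.
Qed.

(** The source of Duplicator's bijections: equally distributed colors can be matched. *)
Lemma bij_of_perm (A B : finType) (C : eqType) (K : A -> C) (K' : B -> C) :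
  perm_eq (map K (enum A)) (map K' (enum B)) ->
  exists2 b : A -> B, bijective b & forall x, K' (b x) = K x.
Proof.
case/perm_map_lift=> t pt Kt.
have ut : uniq t by rewrite (perm_uniq pt) enum_uniq.
have st : size t = #|A| by rewrite -(size_map K') -Kt size_map cardE.
have cAB : #|A| = #|B| by rewrite -st (perm_size pt) cardE.
case: t => [|y0 t'] in pt Kt ut st *.
  have A0 (x : A) : False by have := fintype0 x; rewrite -st.
  exists (fun x => match A0 x with end) => [|x]; last by case: (A0 x).
  by apply: inj_card_bij => [x|]; [case: (A0 x) | rewrite -cAB].
set t := y0 :: t' in pt Kt ut st.
have ltx (x : A) : index x (enum A) < size (enum A) by rewrite index_mem mem_enum.
exists (fun x => nth y0 t (index x (enum A))) => [|x].
  apply: inj_card_bij => [x y /eqP|]; last by rewrite cAB.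
  rewrite nth_uniq // ?st ?cardE ?ltx // => /eqP/(congr1 (nth x (enum A))).
  by rewrite !nth_index ?mem_enum.
rewrite -(nth_map _ (K x)) ?st ?cardE ?ltx // -Kt (nth_map x) ?ltx //.
by rewrite nth_index ?mem_enum.
Qed.

Section Game.
Variables (k : nat).

(** [P] collects positions of the bijective (k+1)-pebble game, as lists of pairs
    of pebbled vertices, from which Duplicator wins. *)
Record game (G G' : sgraph) (P : seq (G * G') -> Prop) : Prop := Game {
  game_nil : P [::];
  game_move : forall s, P s -> size s <= k ->
    exists2 b : G -> G', bijective b & forall w, P ((w, b w) :: s);
  game_sub : forall s t, P s -> size t <= k.+1 -> {subset t <= s} -> P t;
  game_iso : forall s p q, P s -> p \in s -> q \in s ->
    (p.1 == q.1) = (p.2 == q.2) /\ (p.1 -- q.1) = (p.2 -- q.2) }.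

Definition swap_pairs (A B : Type) (s : seq (A * B)) : seq (B * A) :=
  [seq (p.2, p.1) | p <- s].

Lemma mem_swap_pairs (A B : eqType) (s : seq (A * B)) p :
  (p \in swap_pairs s) = ((p.2, p.1) \in s).
Proof.
case: p => x y; apply/mapP/idP => [[[z t] zts [-> ->]] //|yxs].
by exists (y, x).
Qed.

Lemma game_sym (G G' : sgraph) (P : seq (G * G') -> Prop) :
  game P -> game (fun s => P (swap_pairs s)).
Proof.
move=> [P0 Pm Ps Pi]; split=> [//|s Pss les|s t Pss les ts|s p q Pss ps qs].
- have [|b [c bK cK] Pb] := Pm _ Pss; first by rewrite size_map.
  exists c; first by exists b.
  by move=> w; have := Pb (c w); rewrite cK.
- apply: Ps Pss _ _; first by rewrite size_map.
  by move=> p; rewrite !mem_swap_pairs; apply: ts.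
- have [||-> ->] // := Pi _ (p.2, p.1) (q.2, q.1) Pss.
    by rewrite mem_swap_pairs -surjective_pairing.
  by rewrite mem_swap_pairs -surjective_pairing.
Qed.

Lemma game_strategy (G G' : sgraph) (P : seq (G * G') -> Prop) : game P ->
  exists B : seq (G * G') -> G -> G', forall s, P s -> size s <= k ->
    bijective (B s) /\ forall w, P ((w, B s w) :: s).
Proof.
move=> gP; suff /choice[B PB] : forall s, exists b : G -> G',
    P s -> size s <= k -> bijective b /\ forall w, P ((w, b w) :: s).
  by exists B.
move=> s; have [[Ps les]|no] := pselect (P s /\ size s <= k).
  by have [b bb Pb] := game_move gP Ps les; exists b.
(* A total strategy also needs values off the winning positions; the bijection offered at the empty
   position fills them in. *)
have [b _ _] := game_move gP (game_nil gP) (leq0n k).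
by exists b => Ps les; case: no.
Qed.

Definition pairing (A B : Type) (v : {ffun 'I_k -> A}) (v' : {ffun 'I_k -> B}) :=
  [seq (v i, v' i) | i <- enum 'I_k].

Lemma mem_pairing (A B : eqType) (v : {ffun 'I_k -> A}) (v' : {ffun 'I_k -> B}) p :
  reflect (exists i, p = (v i, v' i)) (p \in pairing v v').
Proof.
apply: (iffP mapP) => [[i _ ->]|[i ->]]; first by exists i.
by exists i; rewrite ?mem_enum.
Qed.

Lemma size_pairing (A B : Type) (v : {ffun 'I_k -> A}) (v' : {ffun 'I_k -> B}) :
  size (pairing v v') = k.
Proof. by rewrite size_map -cardE card_ord. Qed.

Lemma mem_wl_range (G : sgraph) (v : {ffun 'I_k -> G}) w :
  (w \in wl_range v) = ((k == 1) ==> [forall i, v i -- w]).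
Proof. by rewrite [LHS]mem_filter [w \in _]mem_enum andbT. Qed.

Section GameToWL.
Variables (G G' : sgraph) (P : seq (G * G') -> Prop).
Hypothesis gP : game P.

(** The tuples occupy [k] pebbles and the extra one goes to [w]; lifting the pebble on entry [j]
    leaves the tuples with [w] substituted at [j]. Duplicator's bijection thus matches the multisets
    of each round. *)
Lemma game_wl i v v' : P (pairing v v') -> @wl k G i v = @wl k G' i v'.
Proof.
elim: i v v' => [|i IHi] v v' Pv /=.
  apply/ffunP=> -[a b]; rewrite !ffunE /=.
  by have [||-> ->] // := game_iso (p := (v a, v' a)) (q := (v b, v' b)) gP Pv;
    apply/mem_pairing; [exists a | exists b].
congr (_, _); first exact: IHi.
apply/eq_seq_msetP.
have [|b [c bK cK] Pb] := game_move gP Pv; first by rewrite size_pairing.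
(* For [k = 1] the range is a neighborhood, which the bijection preserves because adjacency to the
   pebbled vertex is visible in the position. *)
have pb : perm_eq (map b (wl_range v)) (wl_range v').
  have ur (H : sgraph) (u : {ffun 'I_k -> H}) : uniq (wl_range u).
    by rewrite filter_uniq ?enum_uniq.
  apply: uniq_perm => //; first by rewrite map_inj_uniq //; exact: can_inj bK.
  move=> y; rewrite -[y]cK mem_map; last exact: can_inj bK.
  rewrite !mem_wl_range; congr (_ ==> _).
  apply: eq_forallb => j; rewrite cK.
  have [||_ ->] // := game_iso (p := (v j, v' j)) (q := (c y, b (c y))) gP (Pb (c y)).
    by rewrite in_cons orbC; apply/orP; left; apply/mem_pairing; exists j.
  exact: mem_head.
  by rewrite /= cK.
apply: perm_trans (perm_map _ pb); rewrite -map_comp.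
apply/permP=> a; congr (count _ _); apply: eq_map => w; apply/ffunP=> j; rewrite !ffunE.
apply: IHi; apply: (game_sub gP (Pb w)); first by rewrite size_pairing.
move=> p /mem_pairing[l ->]; rewrite !ffunE; case: (l == j); first exact: mem_head.
by rewrite in_cons; apply/orP; right; apply/mem_pairing; exists l.
Qed.

Fixpoint play (B : seq (G * G') -> G -> G') s l :=
  if l is x :: l' then B s x :: play B ((x, B s x) :: s) l' else [::].

Lemma size_play B s l : size (play B s l) = size l.
Proof. by elim: l s => //= x l IHl s; rewrite IHl. Qed.

Section Play.
Variable B : seq (G * G') -> G -> G'.
Hypothesis PB : forall s, P s -> size s <= k ->
  bijective (B s) /\ forall w, P ((w, B s w) :: s).

Lemma play_win s l : P s -> size s + size l <= k -> P (zip l (play B s l) ++ s).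
Proof.
elim: l s => //= x l IHl s Ps lk.
have les : size s <= k by apply: leq_trans lk; apply: leq_addr.
have [_ /(_ x) Px] := PB Ps les.
have /(IHl _ Px) /(game_sub gP) : size ((x, B s x) :: s) + size l <= k.
  by rewrite /= addSnnS.
apply=> /= [|p]; last by rewrite !(in_cons, mem_cat) orbCA.
by rewrite size_cat size_zip size_play minnn addnC ltnS (leq_trans _ lk) ?leq_add2l.
Qed.

(** The strategy depends on the position, but as long as the answers agree so do the positions, and
    at a fixed position the answer is injective. *)
Lemma play_inj s l1 l2 : P s -> size s + size l1 <= k -> size l1 = size l2 ->
  play B s l1 = play B s l2 -> l1 = l2.
Proof.
elim: l1 l2 s => [|x l1 IHl] [|y l2] //= s Ps lk [sl12] [].
have les : size s <= k by apply: leq_trans lk; apply: leq_addr.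
have [/bij_inj Bi /(_ x) Px] := PB Ps les.
by move=> /Bi <- /(IHl l2) -> //=; rewrite addSnnS.
Qed.

End Play.

Lemma game_tuples : exists2 Phi : {ffun 'I_k -> G} -> {ffun 'I_k -> G'},
  injective Phi & forall v, P (pairing v (Phi v)).
Proof.
have [B PB] := game_strategy gP.
pose sq (v : {ffun 'I_k -> G}) := [seq v i | i <- enum 'I_k].
have ssq v : size (sq v) = k by rewrite size_map -cardE card_ord.
(* [G'] is not known to be inhabited, so the default of [nth] is built from [v i]. *)
pose Phi (v : {ffun 'I_k -> G}) := [ffun i : 'I_k => nth (B [::] (v i)) (play B [::] (sq v)) i].
have nthPhi v : play B [::] (sq v) = [seq Phi v i | i <- enum 'I_k].
  case E: (enum 'I_k) => [|i0 e].
    by apply/size0nil; rewrite size_play /sq E.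
  rewrite -{}E; apply: (@eq_from_nth _ (B [::] (v i0))).
    by rewrite size_play ssq size_map -cardE card_ord.
  move=> i; rewrite size_play ssq => ik.
  rewrite (nth_map i0) -?cardE ?card_ord // ffunE nth_enum_ord //.
  by apply: set_nth_default; rewrite size_play ssq.
exists Phi => [v1 v2 eqPhi|v].
  have /play_inj eqv : play B [::] (sq v1) = play B [::] (sq v2) by rewrite !nthPhi eqPhi.
  have {}eqv : sq v1 = sq v2.
    by apply: eqv => //; rewrite ?ssq //; apply: game_nil gP.
  by apply/ffunP=> i; move/eq_in_map: eqv; apply; rewrite mem_enum.
have := @play_win _ PB [::] (sq v) (game_nil gP).
by rewrite ssq => /(_ (leqnn k)); rewrite nthPhi cats0 zip_map.
Qed.

End GameToWL.

(** Stable colors carry their round as a tag, so the stable rounds of the two graphs have to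
    coincide before colors can be compared. *)
Lemma game_wl_stalls (G G' : sgraph) (P : seq (G * G') -> Prop) i : game P ->
  wl_stalls k G i -> wl_stalls k G' i.
Proof.
move=> gP /andP[i0 stall]; rewrite /wl_stalls i0 /=.
have [Phi _ PPhi] := game_tuples (game_sym gP).
have wlPhi j v' : wl j (Phi v') = wl j v'.
  apply: game_wl gP _ _ _ _; have := PPhi v'.
  by rewrite /swap_pairs /pairing -map_comp.
apply/forallP=> v; apply/forallP=> v'.
by have /forallP/(_ (Phi v))/forallP/(_ (Phi v')) := stall; rewrite !wlPhi.
Qed.

Lemma game_wl_stable_round (G G' : sgraph) (P : seq (G * G') -> Prop) : game P ->
  wl_stable_round k G = wl_stable_round k G'.
Proof.
move=> gP; apply: eq_ex_minn => i.
by apply/idP/idP; [apply: game_wl_stalls gP | apply: game_wl_stalls (game_sym gP)].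
Qed.

Lemma game_wl_count_le (G G' : sgraph) (P : seq (G * G') -> Prop) c : game P ->
  @wl_count k G c <= @wl_count k G' c.
Proof.
move=> gP; have [Phi Phi_inj PPhi] := game_tuples gP.
rewrite /wl_count -(card_imset _ Phi_inj); apply: subset_leq_card.
apply/subsetP=> v' /imsetP[v]; rewrite !inE => /eqP <- ->.
by rewrite /wl_stable (game_wl_stable_round gP) (game_wl gP _ (PPhi v)).
Qed.

Lemma game_wl_equiv (G G' : sgraph) (P : seq (G * G') -> Prop) : game P ->
  wl_equiv k G G'.
Proof.
move=> gP [c]; apply; apply/eqP.
by rewrite eqn_leq (game_wl_count_le _ gP) (game_wl_count_le _ (game_sym gP)).
Qed.

End Game.

(** * Weisfeiler-Leman equivalence gives a winning position *)

Lemma ord_unique n (a b : 'I_n) : n = 1 -> a = b.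
Proof. by move=> n1; subst n; rewrite !ord1. Qed.

Section WLToGame.
Variable k : nat.

Lemma wl_down (G G' : sgraph) (v : {ffun 'I_k -> G}) (v' : {ffun 'I_k -> G'}) i j :
  i <= j -> wl j v = wl j v' -> wl i v = wl i v'.
Proof.
elim: j => [|j IHj]; first by rewrite leqn0 => /eqP->.
by rewrite leq_eqVlt ltnS => /orP[/eqP-> //|ij] [/(IHj ij)].
Qed.

Definition wl_key (G : sgraph) i (v : {ffun 'I_k -> G}) w :=
  [ffun j : 'I_k => wl i (subst_at v j w)].

Lemma wl_succ_perm (G G' : sgraph) (v : {ffun 'I_k -> G}) (v' : {ffun 'I_k -> G'}) i :
  wl i.+1 v = wl i.+1 v' ->
  perm_eq [seq wl_key i v w | w <- wl_range v] [seq wl_key i v' w | w <- wl_range v'].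
Proof. by case=> _ /eq_seq_msetP. Qed.

Lemma wl_range_enum (G : sgraph) (v : {ffun 'I_k -> G}) : k != 1 -> wl_range v = enum G.
Proof. by move=> /negPf k1; rewrite /wl_range k1 filter_predT. Qed.

(** Pigeonhole: it frees a coordinate on which a substituted vertex can be placed. *)
Lemma unused_index (rho : 'I_k -> option 'I_k) j : rho j = None ->
  exists l, forall i, rho i <> Some l.
Proof.
move=> rj; apply: contrapT => no.
have /choice[f rf] : forall l, exists i, rho i = Some l.
  by move=> l; apply: contrapT => nl; apply: no; exists l => i ri; apply: nl; exists i.
have fI : injective f by move=> l l' /(congr1 rho); rewrite !rf => -[].
have /codomP[l jE] : j \in codom f by apply: injF_onto.
by have := rf l; rewrite -jE rj.
Qed.

Definition reindex (V : finType) (v : {ffun 'I_k -> V}) (rho : 'I_k -> 'I_k) :=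
  [ffun i => v (rho i)].

Lemma wl_reindex (G G' : sgraph) i (v : {ffun 'I_k -> G}) (v' : {ffun 'I_k -> G'}) rho :
  wl i v = wl i v' -> wl i (reindex v rho) = wl i (reindex v' rho).
Proof.
have [k1|k1] := eqVneq k 1.
  suff re (V : finType) (u : {ffun 'I_k -> V}) : reindex u rho = u by rewrite !re.
  by apply/ffunP=> j; rewrite ffunE (ord_unique (rho j) j k1).
elim: i v v' rho => [|i IHi] v v' rho.
  by move/ffunP=> e; apply/ffunP=> -[a b]; have := e (rho a, rho b); rewrite !ffunE.
move=> e; have /= := wl_succ_perm e; rewrite !wl_range_enum // => pe.
congr (_, _); first by apply: IHi; apply: wl_down e.
apply/eq_seq_msetP.
apply: perm_map_refine pe => w w' _ _ /ffunP eqk; apply/ffunP=> j; rewrite !ffunE.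
have [|l lP] := @unused_index (fun i => if i == j then None else Some (rho i)) j.
  by rewrite eqxx.
have re (V : finType) (u : {ffun 'I_k -> V}) x :
    subst_at (reindex u rho) j x =
    reindex (subst_at u l x) (fun i => if i == j then l else rho i).
  apply/ffunP=> a; rewrite !ffunE; have := lP a; case: (a == j); first by rewrite eqxx.
  by case: eqP => // -> /(_ erefl).
by rewrite !re; apply: IHi; have := eqk l; rewrite !ffunE.
Qed.

Section Equiv.
Variables G G' : sgraph.
Hypothesis eqG : wl_equiv k G G'.

Lemma wl_equiv_count c : @wl_count k G c = @wl_count k G' c.
Proof. by apply: contrapT => h; apply: eqG; exists c. Qed.

Lemma wl_equiv_tuple (v : {ffun 'I_k -> G}) :
  exists v' : {ffun 'I_k -> G'}, wl_stable v = wl_stable v'.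
Proof.
have : 0 < @wl_count k G' (wl_stable v).
  by rewrite -wl_equiv_count; apply/card_gt0P; exists v; rewrite inE.
by case/card_gt0P=> v'; rewrite inE => /eqP e; exists v'.
Qed.

Lemma wl_equiv_round (v : {ffun 'I_k -> G}) : wl_stable_round k G = wl_stable_round k G'.
Proof. by have [v' /(congr1 tag)] := wl_equiv_tuple v. Qed.

Lemma wl_stableE (H H' : sgraph) (v : {ffun 'I_k -> H}) (v' : {ffun 'I_k -> H'}) :
  wl_stable_round k H = wl_stable_round k H' ->
  (wl_stable v == wl_stable v') =
  (wl (wl_stable_round k H) v == wl (wl_stable_round k H) v').
Proof. by rewrite /wl_stable => <-; rewrite eq_Tagged. Qed.

Definition common_round := wl_stable_round k G.

Lemma wl_equiv_card c :
  #|[set v : {ffun 'I_k -> G} | wl common_round v == c]| =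
  #|[set v : {ffun 'I_k -> G'} | wl common_round v == c]|.
Proof.
(* Equality of the stable rounds is read off a tuple; if one graph has no tuples, neither has the
   other. *)
case: (pickP {ffun 'I_k -> G}) => [v _|no]; last first.
  case: (pickP {ffun 'I_k -> G'}) => [v' _|no']; last first.
    by rewrite !eq_card0 // => v; rewrite !inE; [have := no' v | have := no v].
  have : 0 < wl_count G' (wl_stable v') by apply/card_gt0P; exists v'; rewrite inE.
  by rewrite -wl_equiv_count => /card_gt0P[v]; have := no v.
have cE (H : sgraph) : wl_stable_round k H = common_round ->
    wl_count H (Tagged (wl_color k) c) = #|[set u : {ffun 'I_k -> H} | wl common_round u == c]|.
  move=> e; rewrite /wl_count; congr #|pred_of_set _|.
  by apply/setP=> u; rewrite !inE /wl_stable e eq_Tagged.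
by rewrite -!cE ?wl_equiv_count -?(wl_equiv_round v).
Qed.

(** Stability is defined inside one graph; this carries it across. Once equal colors at one round
    force equal colors at the next, the same holds for all later rounds. *)
Lemma wl_equiv_step i (v : {ffun 'I_k -> G}) (v' : {ffun 'I_k -> G'}) :
  wl common_round v = wl common_round v' -> wl i v = wl i v'.
Proof.
have er := wl_equiv_round v; move=> e.
have r0 : 0 < common_round.
  by rewrite /common_round /wl_stable_round; case: ex_minnP => m /andP[].
have stall : wl_stalls k G' common_round.
  by rewrite /common_round er /wl_stable_round; case: ex_minnP.
pose step j := forall (u : {ffun 'I_k -> G}) (u' : {ffun 'I_k -> G'}),
  wl j u = wl j u' -> wl j.+1 u = wl j.+1 u'.
have stepS j : step j -> step j.+1.
  move=> sj u u' eu; congr (_, _); first exact: eu.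
  apply/eq_seq_msetP; apply: perm_map_refine (wl_succ_perm eu) => w w' _ _ /ffunP ew.
  by apply/ffunP=> l; have := ew l; rewrite !ffunE => /sj.
(* [u] has a partner [u1] in [G'] of the same stable color; [u1] and [u'] agree at the round before,
   hence also at the stalled round of [G']. *)
have step0 : step common_round.-1.
  rewrite /step prednK // => u u' eu.
  have [u1 /eqP] := wl_equiv_tuple u; rewrite wl_stableE // => /eqP eu1.
  rewrite -[wl_stable_round _ _]/common_round in eu1.
  have := wl_down (leq_pred _) eu1; rewrite eu => e1.
  have /andP[_ /forallP/(_ u1)/forallP/(_ u')/eqP] := stall.
  by rewrite -e1 eqxx => /eqP <-.
have steps m : step (m + common_round.-1).
  by elim: m => [|m IHm]; rewrite ?add0n // addSn; apply: stepS.
have [ir|ri] := leqP i common_round; first exact: wl_down e.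
have {ri} -> : i = (i - common_round) + common_round by rewrite subnK // ltnW.
elim: (i - _) => [|m IHm]; first by rewrite add0n.
rewrite addSn; have := steps m.+1; rewrite addSn -addnS prednK //; exact.
Qed.

Definition pattern (H : sgraph) (v : {ffun 'I_k -> H}) w :=
  [ffun j : 'I_k => (v j == w, v j -- w)].

(** For [k = 1] the multiset sees only neighbors. The colors of the non-neighbors are obtained by
    removing the vertex itself and its neighbors from the multiset of all vertex colors. *)
Lemma wl_equiv_key (v : {ffun 'I_k -> G}) (v' : {ffun 'I_k -> G'}) : 0 < k ->
  wl common_round v = wl common_round v' ->
  exists2 b : G -> G', bijective b &
    forall w, pattern v' (b w) = pattern v w /\
              wl_key common_round v' (b w) = wl_key common_round v w.
Proof.
move=> k0 e; have /= pe := wl_succ_perm (wl_equiv_step common_round.+1 e).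
pose K (H : sgraph) (u : {ffun 'I_k -> H}) w := (pattern u w, wl_key common_round u w).
suff pK : perm_eq (map (K _ v) (enum G)) (map (K _ v') (enum G')).
  by have [b bb Kb] := bij_of_perm pK; exists b => // w; have [-> ->] := Kb w.
have [k1|k1] := eqVneq k 1; last first.
  rewrite !wl_range_enum // in pe; apply: perm_map_refine pe => w w' _ _ ew.
  congr (_, _) => //; apply/ffunP=> j; rewrite !ffunE.
  (* Substituting at [l] keeps [v j] in the tuple next to [w], so the atomic type shows how the two
     relate. *)
  have [l lj] : exists l : 'I_k, l != j.
    have /card_gt1P[x [y [_ _ xy]]] : 1 < #|'I_k| by rewrite card_ord ltn_neqAle eq_sym k1.
    by have [<-|] := eqVneq x j; [exists y; rewrite eq_sym | exists x].
  have /ffunP/(_ l) := ew; rewrite !ffunE => /(wl_down (leq0n _))/ffunP/(_ (j, l)).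
  by rewrite !ffunE /= eqxx [j == l]eq_sym (negPf lj) => -[-> ->].
pose o := Ordinal k0.
pose col (H : sgraph) w := wl common_round [ffun _ : 'I_k => w : H].
have keyE (H : sgraph) (u : {ffun 'I_k -> H}) w : wl_key common_round u w = [ffun _ => col H w].
  by apply/ffunP=> j; rewrite !ffunE; congr wl; apply/ffunP=> l; rewrite !ffunE (ord_unique l j k1) eqxx.
have constE (H : sgraph) (u : {ffun 'I_k -> H}) : u = [ffun _ => u o].
  by apply/ffunP=> j; rewrite ffunE (ord_unique j o k1).
pose N (H : sgraph) (u : {ffun 'I_k -> H}) := [seq w <- enum H | u o -- w].
pose R (H : sgraph) (u : {ffun 'I_k -> H}) := [seq w <- enum H | (w != u o) && ~~ (u o -- w)].
have split_enum (H : sgraph) (u : {ffun 'I_k -> H}) : perm_eq (enum H) (u o :: R H u ++ N H u).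
  have := enum_uniq H; have : forall w, w \in enum H by move=> w; rewrite mem_enum.
  rewrite /R /N; move: (enum H) => s ms us.
  apply: uniq_perm; rewrite //= ?cat_uniq ?filter_uniq //=.
    rewrite mem_cat !mem_filter eqxx sedge_irr !andbT /=.
    by apply/hasPn=> w; rewrite !mem_filter => /andP[-> _]; rewrite andbF.
  move=> w; rewrite in_cons mem_cat !mem_filter ms !andbT.
  by case: (w == u o); case: (u o -- w).
have pN : perm_eq (map (@col G) (N _ v)) (map (@col G') (N _ v')).
  have NE (H : sgraph) (u : {ffun 'I_k -> H}) : wl_range u = N H u.
    apply: eq_filter => w; rewrite {1}[k == 1](introT eqP k1).
    by apply/forallP/idP => [/(_ o) //|ow j]; rewrite (ord_unique j o k1).
  rewrite !NE in pe; apply: perm_map_refine pe => w w' _ _ /ffunP/(_ o).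
  by rewrite !keyE !ffunE.
have pA : perm_eq (map (@col G) (enum G)) (map (@col G') (enum G')).
  apply/allP=> c _; apply/eqP; rewrite !count_mem_map_enum.
  have cE (H : sgraph) : #|[set w | col H w == c]| = #|[set u : {ffun 'I_k -> H} | wl common_round u == c]|.
    rewrite -(card_imset _ (f := fun w : H => [ffun _ : 'I_k => w])) => [|w w' /ffunP/(_ o)]; last by rewrite !ffunE.
    congr #|pred_of_set _|; apply/setP=> u; rewrite inE; apply/imsetP/idP => [[w]|uc].
      by rewrite inE => /eqP <- ->.
    by exists (u o); rewrite ?inE ?/col -?constE.
  by rewrite !cE wl_equiv_card.
have eo : col G (v o) = col G' (v' o) by rewrite /col -!constE.
have pR : perm_eq (map (@col G) (R _ v)) (map (@col G') (R _ v')).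
  have := perm_map (@col G) (split_enum _ v); rewrite perm_sym.
  move/perm_trans/(_ (perm_trans pA (perm_map _ (split_enum _ v')))).
  rewrite /= eo perm_cons !map_cat => h.
  rewrite -(perm_cat2r (map (@col G') (N _ v'))); apply: perm_trans h.
  by rewrite perm_cat2l perm_sym.
have patE (H : sgraph) (u : {ffun 'I_k -> H}) w : pattern u w = [ffun _ => (u o == w, u o -- w)].
  by apply/ffunP=> j; rewrite !ffunE (ord_unique j o k1).
have KE (H : sgraph) (u : {ffun 'I_k -> H}) w :
    K H u w = ([ffun _ => (u o == w, u o -- w)], [ffun _ => col H w]).
  by rewrite /K patE keyE.
apply: perm_trans (perm_map _ (split_enum _ v)) _; rewrite perm_sym.
apply: perm_trans (perm_map _ (split_enum _ v')) _; rewrite perm_sym /=.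
rewrite !KE !eqxx !sedge_irr eo perm_cons !map_cat; apply: perm_cat.
  apply: perm_map_refine pR => w w'; rewrite !mem_filter !KE.
  move=> /andP[/andP[wo /negPf ow] _] /andP[/andP[wo' /negPf ow'] _] ->.
  by rewrite ow ow' eq_sym (negPf wo) eq_sym (negPf wo').
apply: perm_map_refine pN => w w'; rewrite !mem_filter !KE.
move=> /andP[ow _] /andP[ow' _] ->; rewrite ow ow'.
have neq (H : sgraph) (x y : H) : x -- y -> (x == y) = false.
  by case: eqP => // ->; rewrite sedge_irr.
by rewrite !neq.
Qed.


(** Duplicator's answer on the empty board. Being constant is part of the atomic type, so the stable
    colors of constant tuples are equally distributed. *)
Lemma bij_const_tuples : 0 < k -> exists2 b : G -> G', bijective b &
  forall w, wl common_round [ffun _ : 'I_k => w] = wl common_round [ffun _ : 'I_k => b w].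
Proof.
move=> k0; pose o := Ordinal k0.
pose col (H : sgraph) w := wl common_round [ffun _ : 'I_k => w : H].
suff [b bb cb] : exists2 b : G -> G', bijective b & forall w, col G' (b w) = col G w.
  by exists b => // w; rewrite [RHS]cb.
apply: bij_of_perm; apply/allP=> c _; apply/eqP; rewrite !count_mem_map_enum.
pose const (H : sgraph) (u : {ffun 'I_k -> H}) := [forall i, u i == u o].
have const_wl (H H' : sgraph) (u : {ffun 'I_k -> H}) (u' : {ffun 'I_k -> H'}) :
    wl common_round u = wl common_round u' -> const H u = const H' u'.
  move/(wl_down (leq0n _))/ffunP=> e; apply: eq_forallb => i.
  by have := e (i, o); rewrite !ffunE => -[].
have constE (H : sgraph) (u : {ffun 'I_k -> H}) : const H u -> u = [ffun _ => u o].
  by move/forallP=> cu; apply/ffunP=> j; rewrite ffunE; apply/eqP.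
have cE (H : sgraph) : #|[set w | col H w == c]| =
    #|[set u : {ffun 'I_k -> H} | (wl common_round u == c) && const H u]|.
  rewrite -(card_imset _ (f := fun w : H => [ffun _ : 'I_k => w])) => [|w w' /ffunP/(_ o)];
    last by rewrite !ffunE.
  congr #|pred_of_set _|; apply/setP=> u; rewrite inE; apply/imsetP/andP => [[w]|[uc cu]].
    by rewrite inE => /eqP <- ->; split=> //; apply/forallP=> i; rewrite !ffunE.
  by exists (u o); rewrite ?inE ?/col -?constE.
rewrite !cE.
pose L (H : sgraph) (u : {ffun 'I_k -> H}) := (wl common_round u, const H u).
have /permP/(_ (pred1 (c, true))) :
    perm_eq (map (L G) (enum {ffun 'I_k -> G})) (map (L G') (enum {ffun 'I_k -> G'})).
  have pT : perm_eq (map (@wl k G common_round) (enum {ffun 'I_k -> G}))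
                    (map (@wl k G' common_round) (enum {ffun 'I_k -> G'})).
    by apply/allP=> d _; apply/eqP; rewrite !count_mem_map_enum wl_equiv_card.
  by apply: perm_map_refine pT => u u' _ _ e; rewrite /L (const_wl _ _ _ _ e) e.
rewrite !count_mem_map_enum => e; apply: etrans (etrans _ e) _;
  congr #|pred_of_set _|; apply/setP=> u; rewrite !inE xpair_eqE eqb_id //.
Qed.

(** Quantifying over all tuples supported on [s] makes order and repetition of pebbles irrelevant.
    For [k = 1] a tuple holds one vertex and cannot show how two pebbles relate, hence the separate
    isomorphism clause. *)
Definition wl_winning (s : seq (G * G')) :=
  (forall p q, p \in s -> q \in s ->
     (p.1 == q.1) = (p.2 == q.2) /\ (p.1 -- q.1) = (p.2 -- q.2)) /\
  forall (v : {ffun 'I_k -> G}) (v' : {ffun 'I_k -> G'}),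
    {subset pairing v v' <= s} -> wl common_round v = wl common_round v'.

Lemma wl_winning_cons (v : {ffun 'I_k -> G}) (v' : {ffun 'I_k -> G'}) w w' :
  wl_winning (pairing v v') -> pattern v' w' = pattern v w ->
  wl_key common_round v' w' = wl_key common_round v w ->
  wl_winning ((w, w') :: pairing v v').
Proof.
move=> [iso wlP] /ffunP pat /ffunP key; split.
  move=> p q; rewrite !in_cons => /predU1P[->|ps] /predU1P[->|qs] /=.
  - by rewrite !eqxx !sedge_irr.
  - have /mem_pairing[j ->] := qs; have := pat j; rewrite !ffunE => -[/= e1 e2].
    by rewrite [w == _]eq_sym [w' == _]eq_sym e1 ![_ -- v _]sedge_sym ![_ -- v' _]sedge_sym e2.
  - by have /mem_pairing[j ->] := ps; have := pat j; rewrite !ffunE => -[-> ->].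
  - exact: iso.
move=> u u' sub_u.
have /choice[rho rhoP] : forall i, exists o : option 'I_k,
    (u i, u' i) = if o is Some j then (v j, v' j) else (w, w').
  move=> i; have /predU1P[->|/mem_pairing[j ->]] : (u i, u' i) \in (w, w') :: pairing v v'.
  - by apply: sub_u; apply/mem_pairing; exists i.
  - by exists None.
  - by exists (Some j).
case: (pickP (fun i => rho i == None)) => [i0 /eqP ri0|allS].
  have [l lP] := unused_index ri0.
  have uE (H : sgraph) (x y : {ffun 'I_k -> H}) z :
      (forall i, x i = if rho i is Some j then y j else z) ->
      x = reindex (subst_at y l z) (fun i => odflt l (rho i)).
    move=> xE; apply/ffunP=> i; rewrite !ffunE xE; have := lP i.
    by case: (rho i) => [j|] /=; rewrite ?eqxx //; case: eqP => // ->.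
  have -> : u = reindex (subst_at v l w) (fun i => odflt l (rho i)).
    by apply: uE => i; have := rhoP i; case: (rho i) => [j|] [].
  have -> : u' = reindex (subst_at v' l w') (fun i => odflt l (rho i)).
    by apply: uE => i; have := rhoP i; case: (rho i) => [j|] [].
  by apply: wl_reindex; have := key l; rewrite !ffunE.
have uE (H : sgraph) (x y : {ffun 'I_k -> H}) z :
    (forall i, x i = if rho i is Some j then y j else z) ->
    x = reindex y (fun i => odflt i (rho i)).
  by move=> xE; apply/ffunP=> i; rewrite !ffunE xE; have := allS i; case: (rho i).
have -> : u = reindex v (fun i => odflt i (rho i)).
  by apply: (uE _ _ _ w) => i; have := rhoP i; case: (rho i) => [j|] [].
have -> : u' = reindex v' (fun i => odflt i (rho i)).
  by apply: (uE _ _ _ w') => i; have := rhoP i; case: (rho i) => [j|] [].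
by apply: wl_reindex; apply: wlP.
Qed.

Lemma wl_equiv_game : 0 < k -> game k wl_winning.
Proof.
move=> k0; have w_sub s t : {subset t <= s} -> wl_winning s -> wl_winning t.
  move=> ts [iso wlP]; split=> [p q /ts ps /ts qs|v v' vt]; first exact: iso.
  by apply: wlP => p /vt /ts.
split=> [|s ws les|s t ws _ ts|s p q [iso _]]; last exact: iso.
- split=> // v v' /(_ (v (Ordinal k0), v' (Ordinal k0))) h.
  by have /h : (v (Ordinal k0), v' (Ordinal k0)) \in pairing v v'
    by apply/mem_pairing; exists (Ordinal k0).
- case: s => [|p0 s] in ws les *.
    have [b bb wlb] := bij_const_tuples k0; exists b => // w; split.
      by move=> p q; rewrite !inE => /eqP-> /eqP->; rewrite !eqxx !sedge_irr.
    move=> v v' vw; suff [-> ->] : v = [ffun _ => w] /\ v' = [ffun _ => b w] by [].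
    by split; apply/ffunP=> j; rewrite ffunE;
      have : (v j, v' j) \in [:: (w, b w)] by [apply: vw; apply/mem_pairing; exists j];
      rewrite inE => /eqP[].
  set t := p0 :: s in ws les *.
  (* Fewer than [k] pairs are padded to a tuple by repeating [p0]. *)
  pose v := [ffun i : 'I_k => (nth p0 t i).1].
  pose v' := [ffun i : 'I_k => (nth p0 t i).2].
  have vt : {subset pairing v v' <= t}.
    move=> p /mem_pairing[i ->]; rewrite !ffunE -surjective_pairing.
    have [it|ti] := ltnP i (size t); first exact: mem_nth.
    by rewrite nth_default // mem_head.
  have tv : {subset t <= pairing v v'}.
    move=> p pt; have ip : index p t < k by apply: leq_trans les; rewrite index_mem.
    apply/mem_pairing; exists (Ordinal ip).
    by rewrite !ffunE /= nth_index // -surjective_pairing.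
  have wv := w_sub _ _ vt ws.
  have [|b bb bP] := wl_equiv_key (v := v) (v' := v') k0; first by apply: (proj2 wv) => p.
  exists b => // w; have [pat key] := bP w.
  apply: w_sub (wl_winning_cons wv pat key) => p; rewrite !in_cons => /orP[-> //|/tv ->].
  by rewrite orbT.
- exact: w_sub ts ws.
Qed.

End Equiv.
End WLToGame.

(** * Homomorphism counts *)

Section ValidBags.
Variable V : finType.

Definition bag_union (L : seq {set V}) := \bigcup_(b <- L) b.

(** The bags of a rooted tree decomposition, root last: each bag meets the union
    of those after it inside a single one of them, its parent. *)
Fixpoint valid_bags (L : seq {set V}) : bool :=
  if L is b :: L' then
    valid_bags L' && (nilp L' || has (fun c : {set V} => b :&: bag_union L' \subset c) L')
  else true.

Lemma mem_bag_union L v : (v \in bag_union L) = has (fun b : {set V} => v \in b) L.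
Proof.
rewrite /bag_union; elim: L => [|b L IHL]; first by rewrite big_nil inE.
by rewrite big_cons inE IHL.
Qed.

End ValidBags.

Definition homs (F G : sgraph) : {set {ffun F -> G}} :=
  [set f : {ffun F -> G} | [forall x, [forall y, x -- y ==> f x -- f y]]].

Lemma homsP (F G : sgraph) (f : {ffun F -> G}) :
  reflect (forall x y, x -- y -> f x -- f y) (f \in homs F G).
Proof.
rewrite inE; apply: (iffP forallP) => h x.
  by move=> y; have /forallP/(_ y)/implyP := h x.
by apply/forallP=> y; apply/implyP; apply: h.
Qed.

Section GameHoms.
Variables (k : nat) (G G' : sgraph) (P : seq (G * G') -> Prop).
Hypothesis gP : game k P.
Variable F : finType.

(** [Phi] replays Duplicator's bijections along the bags; it need only be
    injective on the vertices [D] handled so far. *)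
Definition transports (D : {set F}) (C : seq {set F}) :=
  exists Phi : (F -> G) -> F -> G',
    (forall f g, {in D, Phi f =1 Phi g} -> {in D, f =1 g}) /\
    (forall b f, b \in C -> P [seq (f x, Phi f x) | x <- enum b]).

(** The image of [u] is Duplicator's answer at the position on [b]. Two maps with equal images agree
    on [D], hence reach the same position on [b], where the answer is injective. *)
Lemma transports_vertex (D : {set F}) (C : seq {set F}) (b : {set F}) u :
  all (fun c : {set F} => c \subset D) C -> b \subset D ->
  (b == set0) || has (fun c : {set F} => b \subset c) C -> #|b| <= k -> u \notin D ->
  transports D C -> transports (u |: D) ((u |: b) :: C).
Proof.
move=> /allP CD bD bC bk uD [Phi [Phi_inj PhiC]].
have [B PB] := game_strategy gP.
have Pb f : P [seq (f x, Phi f x) | x <- enum b].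
  case/orP: bC => [/eqP->|/hasP[c cC /subsetP bc]].
    by rewrite enum_set0; apply: game_nil gP.
  apply: (game_sub gP (PhiC c f cC)); first by rewrite size_map -cardE ltnW.
  by move=> p /mapP[x]; rewrite mem_enum => /bc xc ->; apply: map_f; rewrite mem_enum.
have szb f : size [seq (f x, Phi f x) | x <- enum b] <= k by rewrite size_map -cardE.
pose Psi f x := if x == u then B [seq (f y, Phi f y) | y <- enum b] (f u) else Phi f x.
have PsiD f x : x \in D -> Psi f x = Phi f x.
  by rewrite /Psi; case: eqP => // ->; rewrite (negPf uD).
exists Psi; split=> [f g fg|c f]; last first.
  rewrite in_cons => /predU1P[->|cC]; last first.
    rewrite (_ : map _ _ = [seq (f x, Phi f x) | x <- enum c]); first exact: PhiC.
    by apply/eq_in_map=> x; rewrite mem_enum => /(subsetP (CD _ cC)) xD; rewrite PsiD.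
  have [_ /(_ (f u))] := PB _ (Pb f) (szb f).
  move/(game_sub gP); apply.
    rewrite size_map -cardE (leq_trans (leq_card_setU _ _)) // cards1 //.
  move=> p /mapP[x]; rewrite mem_enum !inE => /predU1P[-> ->|xb ->].
    by rewrite /Psi eqxx eqxx.
  by rewrite PsiD ?(subsetP bD) //; apply/orP; right; apply: map_f; rewrite mem_enum.
have fgD : {in D, f =1 g}.
  by apply: Phi_inj => x xD; rewrite -!PsiD ?fg // inE xD orbT.
have fgb : [seq (f x, Phi f x) | x <- enum b] = [seq (g x, Phi g x) | x <- enum b].
  apply/eq_in_map=> x; rewrite mem_enum => /(subsetP bD) xD.
  by rewrite -!PsiD // fg ?inE ?xD ?orbT // fgD.
move=> x; rewrite !inE => /predU1P[->|]; last exact: fgD.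
have := fg u; rewrite /Psi eqxx !inE eqxx => /(_ isT); rewrite fgb.
by have [/bij_inj Bi _] := PB _ (Pb g) (szb g); apply: Bi.
Qed.

(** The bag is filled vertex by vertex, each partial bag serving as the parent of the next and being
    dropped at the end. *)
Lemma transports_bag (D : {set F}) (C : seq {set F}) (b : {set F}) :
  all (fun c : {set F} => c \subset D) C -> #|b| <= k.+1 ->
  (b :&: D == set0) || has (fun c : {set F} => b :&: D \subset c) C ->
  transports D C -> transports (D :|: b) (b :: C).
Proof.
move=> CD; elim: {b}_.+1 {-2}b (ltnSn #|b :\: D|) => // n IHn b bn bk bC TC.
have [bD|] := boolP (b \subset D).
  have [Phi [Phi_inj PhiC]] := TC; exists Phi; split.
    move=> f g fg x; rewrite (setUidPl bD); apply: Phi_inj => {}x xD.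
    by apply: fg; rewrite inE xD.
  move=> c f; rewrite in_cons => /predU1P[->|]; last exact: PhiC.
  move: bC; rewrite (setIidPl bD) => /orP[/eqP->|/hasP[c' cC /subsetP bc]].
    by rewrite enum_set0; apply: game_nil gP.
  apply: (game_sub gP (PhiC c' f cC)); first by rewrite size_map -cardE.
  by move=> p /mapP[x]; rewrite mem_enum => /bc xc ->; apply: map_f; rewrite mem_enum.
case/subsetPn=> u ub uD; set a := b :\ u.
have aD : a :&: D = b :&: D.
  apply/setP=> x; rewrite !inE; case: eqP => // ->.
  by rewrite (negPf uD) !andbF.
have ua : u |: a = b by rewrite setD1K.
have ak : #|a| <= k by move: bk; rewrite (cardsD1 u b) ub.
have Ta : transports (D :|: a) (a :: C).
  apply: IHn; rewrite ?aD //; last exact: leqW.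
  rewrite ltnS in bn; apply: leq_trans bn; apply: proper_card.
  by apply/properP; split; [apply: setSD; apply: subsetDl | exists u; rewrite !inE ?eqxx ?ub ?uD].
have : transports (D :|: b) (b :: a :: C).
  rewrite -ua setUCA; apply: transports_vertex => //.
  - rewrite /= subsetUr; apply/allP=> c /(allP CD) cD.
    exact: subset_trans cD (subsetUl _ _).
  - exact: subsetUr.
  - by rewrite /= subxx orbT.
  - by rewrite !inE eqxx (negPf uD).
case=> Phi [Phi_inj PhiC].
exists Phi; split=> // c f; rewrite in_cons => cC; apply: PhiC.
by rewrite !in_cons; case/orP: cC => ->; rewrite ?orbT.
Qed.

Lemma transports_valid (L : seq {set F}) : valid_bags L ->
  all (fun b : {set F} => #|b| <= k.+1) L -> transports (bag_union L) L.
Proof.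
elim: L => [_ _|b L IHL /= /andP[vL hL] /andP[bk Lk]].
  have [b _ _] := game_move gP (game_nil gP) (leq0n k).
  by exists (fun f x => b (f x)); split=> [f g _ x|]; rewrite /bag_union ?big_nil ?inE.
rewrite /bag_union big_cons setUC; apply: transports_bag => //; last exact: IHL.
  by apply/allP=> c cL; apply/subsetP=> v vc; rewrite mem_bag_union; apply/hasP; exists c.
case/orP: hL => [/nilP->|->]; last by rewrite orbT.
by rewrite big_nil setI0 eqxx.
Qed.

End GameHoms.

Lemma game_leq_homs k (G G' : sgraph) (P : seq (G * G') -> Prop) (F : sgraph)
    (L : seq {set F}) :
  game k P -> valid_bags L -> all (fun b : {set F} => #|b| <= k.+1) L ->
  (forall v, exists2 b, b \in L & v \in b) ->
  (forall v w, v -- w -> exists2 b, b \in L & (v \in b) && (w \in b)) ->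
  #|homs F G| <= #|homs F G'|.
Proof.
move=> gP vL Lk cover edge.
have [Phi [Phi_inj PhiL]] := transports_valid gP vL Lk.
pose Psi (f : {ffun F -> G}) := [ffun x => Phi f x].
have Psi_inj : injective Psi.
  move=> f g /ffunP fg; apply/ffunP=> x; apply: Phi_inj => [y _|].
    by have := fg y; rewrite !ffunE.
  by have [b bL xb] := cover x; rewrite mem_bag_union; apply/hasP; exists b.
rewrite -(card_imset _ Psi_inj); apply: subset_leq_card.
apply/subsetP=> _ /imsetP[f /homsP hf ->]; apply/homsP=> x y xy; rewrite !ffunE.
have [b bL /andP[xb yb]] := edge _ _ xy.
have [||_ /= <-] := game_iso (p := (f x, Phi f x)) (q := (f y, Phi f y)) gP (PhiL b f bL).
- by apply/mapP; exists x; rewrite ?mem_enum.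
- by apply/mapP; exists y; rewrite ?mem_enum.
exact: hf.
Qed.

(** * Tree decompositions as lists of bags *)

Definition rel_in (T : finType) (e : rel T) (A : pred T) :=
  [rel a b | [&& e a b, A a & A b]].

Lemma connect_in_path (T : finType) (e : rel T) (A : pred T) x y :
  A x -> connect (rel_in e A) x y ->
  exists q, [/\ path e x q, last x q = y, uniq (x :: q) & all A (x :: q)].
Proof.
move=> Ax /connectP[q0 /shortenP[q pq uq _] ->]; exists q; split=> //.
  by apply: sub_path pq => a b /and3P[].
rewrite /= Ax; elim: q x Ax pq {uq q0} => //= z q IHq x _ /andP[/and3P[_ _ Az] pq].
by rewrite Az; apply: IHq pq.
Qed.

Section TreeToBags.
Variables (T : sgraph).
Hypothesis treeT : is_tree T.

(** Otherwise the path outside [s] from [t] to [z0] and a path inside [s] from [z] to [p] close up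
    to a cycle on more than two nodes. *)
Lemma tree_attachment (s : pred T) t p z0 z :
  {in s &, forall x y, connect (rel_in (@sedge T) s) x y} ->
  ~~ s t -> s p -> t -- p -> connect (rel_in (@sedge T) (predC s)) t z0 ->
  z0 -- z -> s z -> z = p.
Proof.
move=> cs st sp tp /(connect_in_path (A := predC s) st)[q [pq lq uq aq]] z0z sz.
have /(connect_in_path (A := s) sz)[r [pr lr ur ar]] := cs z p sz sp.
have [_ _ short] := treeT.
have : ucycle (@sedge T) (t :: q ++ z :: r).
  apply/andP; split.
    rewrite /= rcons_path cat_path /= pq lq z0z pr last_cat /= lr sedge_sym //.
  rewrite -cat_cons cat_uniq uq ur andbT; apply/hasPn=> y /(allP ar) sy.
  by apply/negP=> /(allP aq) /negP.
move/short; rewrite /= size_cat /= addnS !ltnS leqn0 addn_eq0.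
by move=> /andP[_ /eqP/size0nil r0]; move: lr; rewrite r0.
Qed.

Lemma tree_connect_exit (A s : pred T) t z : connect (rel_in (@sedge T) A) t z ->
  ~~ s t -> s z -> exists a b,
  [/\ connect (rel_in (@sedge T) (predC s)) t a, a -- b, s b & A b].
Proof.
case/connectP=> q; elim: q t => [|x q IHq] t /=; first by move=> _ -> /negPf ->.
move=> /andP[/and3P[tx At Ax] pq] zE st sz.
have [sx|sx] := boolP (s x); first by exists t, x; split.
have [a [b [xa ab sb Ab]]] := IHq x pq zE sx sz.
exists a, b; split=> //; apply: connect_trans xa; apply: connect1.
by rewrite /= tx st.
Qed.

Variables (G : sgraph) (B : T -> {set G}).
Hypothesis tdB : tree_decomposition B.

Let good (s : seq T) := [/\ s != [::],
  uniq s, valid_bags (map B s)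
  & {in s &, forall x y, connect (rel_in (@sedge T) (mem s)) x y}].

(** A new node [t] next to the subtree [s] hangs on a single [p] in [s]. If [v] lies in the bag of
    [t] and in a bag of [s], the path of bags containing [v] enters [s] at [p], so [B p] is the
    required parent. *)
Lemma tree_grow s : good s -> size s < #|T| -> exists t, good (t :: s).
Proof.
move=> [s0 us vs cs] ltT.
have [p [t [sp st pt]]] : exists p t, [/\ p \in s, t \notin s & p -- t].
  apply: contrapT => no.
  have cl : closed (@sedge T) (mem s).
    move=> x y xy; apply: contrapT => neq; apply: no.
    case xs: (x \in mem s) neq; case ys: (y \in mem s) => // _.
      by exists x, y; split; [exact: xs | exact: negbT ys |].
    by exists y, x; split; [exact: ys | exact: negbT xs | rewrite sedge_sym].
  have [x xs] : exists x, x \in s by case: (s) s0 => // x ?; exists x; rewrite mem_head.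
  have [_ cT _] := treeT.
  have := ltT; rewrite -[X in X < _](card_uniqP us) ltnNge => /negP; apply.
  apply: subset_leq_card; apply/subsetP=> y _.
  by have <- : (x \in s) = (y \in s) := closed_connect cl (cT x y).
exists t; split=> //=; rewrite ?st //.
  rewrite vs /=; apply/orP; right; apply/hasP; exists (B p); first exact: map_f.
  apply/subsetP=> v; rewrite inE mem_bag_union has_map => /andP[vt /hasP[z zs /= vz]].
  have [_ _ _ /(_ v t z vt vz) ctz] := tdB.
  have ctz' : connect (rel_in (@sedge T) (fun a => v \in B a)) t z by exact: ctz.
  have [a [b [ta ab bs vb]]] := tree_connect_exit ctz' st zs.
  by rewrite -(tree_attachment cs st sp _ ta ab bs) // sedge_sym.
pose e : rel T := rel_in (@sedge T) (mem (t :: s)).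
have sub_s x y : connect (rel_in (@sedge T) (mem s)) x y -> connect e x y.
  apply: connect_sub => a b /and3P[ab sa sb]; apply: connect1.
  by rewrite /e /= ab !in_cons; rewrite /= in sa sb; rewrite sa sb !orbT.
have tp : e t p by rewrite /e /= sedge_sym pt mem_head in_cons sp orbT.
have pt' : e p t by rewrite /e /= pt mem_head in_cons sp orbT.
suff : {in t :: s &, forall x y, connect e x y} by [].
move=> x y; rewrite !in_cons => /predU1P[->|xs] /predU1P[->|ys].
- exact: connect0.
- by apply: (connect_trans (connect1 tp)); apply: sub_s; apply: cs.
- by apply: (connect_trans _ (connect1 pt')); apply: sub_s; apply: cs.
- by apply: sub_s; apply: cs.
Qed.

Lemma tree_decomposition_valid : exists s : seq T,
  valid_bags (map B s) /\ forall t, t \in s.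
Proof.
have [s [[s0 us vs _] sT]] : exists s, good s /\ #|T| <= size s.
  have : exists s, good s.
    have [/card_gt0P[t _] _ _] := treeT; exists [:: t]; split=> //=.
    by move=> x y; rewrite !inE => /eqP-> /eqP->; apply: connect0.
  case=> s; elim: {s}(#|T| - size s) {-2}s (leqnn (#|T| - size s)) => [|n IHn] s.
    by rewrite leqn0 subn_eq0 => ? ?; exists s.
  have [? _ ?|ltT le gs] := leqP #|T| (size s); first by exists s.
  have [t gt] := tree_grow gs ltT; apply: IHn gt => /=.
  by rewrite subnS -subn1 leq_subLR add1n.
exists s; split=> // t; have : s =i T; last by move->.
by apply/subset_cardP; [apply/eqP; rewrite eqn_leq max_card (card_uniqP us) | apply/subsetP].
Qed.

End TreeToBags.

Lemma treewidth_decomposition (G : sgraph) : exists (T : sgraph) (B : T -> {set G}),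
  tree_decomposition B /\ forall t, #|B t| <= (treewidth G).+1.
Proof.
rewrite /treewidth; case: ex_minnP => m /asboolP[T [B [tdB <-]]] _.
exists T, B; split=> // t; apply: leq_trans (leqSpred _).
exact: (leq_bigmax_cond (F := fun t => #|B t|)).
Qed.

Lemma treewidth_valid (G : sgraph) : exists L : seq {set G},
  [/\ valid_bags L, all (fun b : {set G} => #|b| <= (treewidth G).+1) L,
      forall v, exists2 b, b \in L & v \in b
    & forall v w, v -- w -> exists2 b, b \in L & (v \in b) && (w \in b)].
Proof.
have [T [B [tdB leB]]] := treewidth_decomposition G.
have [treeT edge cover _] := tdB.
have [s [vs sT]] := tree_decomposition_valid treeT tdB.
exists (map B s); split=> // [|v|v w /edge[t vw]].
- by apply/allP=> _ /mapP[t _ ->].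
- by have [t vt] := cover v; exists (B t); rewrite ?map_f.
- by exists (B t); rewrite ?map_f.
Qed.

(** * From lists of bags back to trees *)

Section ParentTree.
Variables (n : nat) (par : 'I_n.+1 -> 'I_n.+1).
Hypothesis ltpar : forall i : 'I_n.+1, i < n -> i < par i.

(** The strict inequalities discard the value of [par] at the last index, which is the root. *)
Definition parent_rel : rel 'I_n.+1 :=
  fun i j => (i < j) && (par i == j) || (j < i) && (par j == i).

Lemma parent_rel_sym : symmetric parent_rel.
Proof. by move=> i j; rewrite /parent_rel orbC. Qed.

Lemma parent_rel_irr : irreflexive parent_rel.
Proof. by move=> i; rewrite /parent_rel ltnn. Qed.

Definition parent_tree := SGraph parent_rel_sym parent_rel_irr.

Lemma parent_rel_par (i : 'I_n.+1) : i < n -> parent_rel i (par i).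
Proof. by move=> /ltpar lt_i; rewrite /parent_rel lt_i eqxx. Qed.

Lemma parent_connect_top (A : pred 'I_n.+1) (i j : 'I_n.+1) :
  (forall i : 'I_n.+1, A i -> i < j -> A (par i)) -> A i -> i <= j ->
  (forall l : 'I_n.+1, A l -> l <= j) ->
  connect (rel_in parent_rel A) i j.
Proof.
move=> Apar Ai ij maxj.
elim: {i}(j - i) {-2}i (leqnn (j - i)) Ai ij => [|m IHm] i.
  by rewrite leqn0 subn_eq0 => ji _ ij; rewrite (@ord_inj _ i j) ?connect0 //; apply/eqP; rewrite eqn_leq ij.
move=> le Ai; rewrite leq_eqVlt => /orP[/eqP/ord_inj->|ij]; first exact: connect0.
have i_n : i < n by apply: leq_trans ij _; rewrite -ltnS.
have Ap := Apar _ Ai ij; apply: (@connect_trans _ _ (par i)).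
  by apply: connect1; rewrite /= parent_rel_par // Ai.
apply: IHm => //; last exact: maxj.
rewrite -ltnS (leq_trans _ le) // ltn_sub2l ?ltpar //.
Qed.

(** The least node of a longer cycle would have two distinct neighbors above it, both equal to its
    parent. *)
Lemma parent_is_tree : is_tree parent_tree.
Proof.
have top (i : 'I_n.+1) : connect parent_rel i ord_max.
  have := @parent_connect_top predT i ord_max.
  move/(_ (fun _ _ _ => isT) isT (leq_ord _) (fun l _ => leq_ord l)).
  by apply: connect_sub => a b /andP[ab _]; apply: connect1.
split=> [|s t|c].
- by rewrite card_ord.
- apply: connect_trans (top s) _; rewrite (sym_connect_sym parent_rel_sym); apply: top.
- case: c => [//|x0 c] uc.
  have x0c : x0 \in x0 :: c by apply: mem_head.
  pose m := [arg min_(i < x0 in x0 :: c) (i : 'I_n.+1) : nat].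
  have [mc minm] : m \in x0 :: c /\ forall y : 'I_n.+1, y \in x0 :: c -> m <= y.
    by rewrite /m; case: arg_minnP.
  have [r c' E] := rot_to mc.
  have : ucycle (@sedge parent_tree) (m :: c') by rewrite -E rot_ucycle.
  have {}minm : forall y : 'I_n.+1, y \in m :: c' -> m <= y.
    by move=> y; rewrite -E mem_rot; apply: minm.
  rewrite -(size_rot r) E; case: c' E minm => [//|a c'] _ minm.
  case/lastP: c' minm => [//|c' z] minm.
  rewrite /ucycle /= rcons_path last_rcons => /andP[/and3P[ma _ zm] /and3P[_ az _]].
  have {az} a_z : a != z by apply: contraNneq az => ->; rewrite mem_rcons mem_head.
  have below y : y \in [:: m, a & rcons c' z] -> parent_rel m y -> par m = y.
    move=> /minm my; rewrite /parent_rel => /orP[/andP[_ /eqP]//|/andP[ym _]].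
    by rewrite ltnNge my in ym.
  case/eqP: a_z; rewrite -(below a) ?(below z) //.
  + by rewrite in_cons in_cons mem_rcons mem_head !orbT.
  + by rewrite parent_rel_sym.
  + by rewrite in_cons mem_head orbT.
Qed.

End ParentTree.

Lemma valid_bags_parent (V : finType) (L : seq {set V}) i : valid_bags L ->
  i.+1 < size L -> exists j, [/\ i < j, j < size L &
    nth set0 L i :&: bag_union (drop i.+1 L) \subset nth set0 L j].
Proof.
elim: L i => //= b L IHL [|i] /andP[vL hL].
  rewrite ltnS lt0n; case/orP: hL => [/nilP->//|/hasP[c cL bc] _].
  exists (index c L).+1; split=> //=; first by rewrite ltnS index_mem.
  by rewrite drop0 nth_index.
rewrite ltnS => /(IHL i vL)[j [ij jL sub_j]].
by exists j.+1.
Qed.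

Lemma valid_treewidth (G : sgraph) (L : seq {set G}) k : L != [::] ->
  valid_bags L -> all (fun b : {set G} => #|b| <= k.+1) L ->
  (forall v, exists2 b, b \in L & v \in b) ->
  (forall v w, v -- w -> exists2 b, b \in L & (v \in b) && (w \in b)) ->
  treewidth G <= k.
Proof.
case E: {1}L => [//|b0 L0] _ vL Lk cover edge.
pose n := size L0; have sL : size L = n.+1 by rewrite E.
have /choice[par0 par0P] : forall i : 'I_n.+1, exists j : 'I_n.+1, i < n ->
    i < j /\ nth set0 L i :&: bag_union (drop i.+1 L) \subset nth set0 L j.
  move=> i; have [i_n|_] := ltnP i n; last by exists i.
  have [|j [ij jL sub_j]] := valid_bags_parent (i := i) vL; first by rewrite sL ltnS.
  by rewrite sL in jL; exists (Ordinal jL).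
have ltpar (i : 'I_n.+1) : i < n -> i < par0 i by move=> /par0P[].
pose B (i : parent_tree par0) := nth set0 L i.
have mem_bag b : b \in L -> exists i, B i = b.
  move=> bL; have ib : index b L < n.+1 by rewrite -sL index_mem.
  by exists (Ordinal ib); rewrite /B /= nth_index.
have tdB : tree_decomposition B.
  split; first exact: parent_is_tree.
  - by move=> v w /edge[_ /mem_bag[i <-] vw]; exists i.
  - by move=> v; have [_ /mem_bag[i <-] vi] := cover v; exists i.
  - move=> v s t vs vt.
    pose A : pred 'I_n.+1 := fun i => v \in B i.
    (* [m] is the highest bag containing [v]. Any lower bag with [v] shares [v] with the bags after
       it, so its parent contains [v] too, and both [s] and [t] climb to [m]. *)
    pose m := [arg max_(i > s | A i) (i : 'I_n.+1) : nat].
    have [Am maxm] : A m /\ forall y : 'I_n.+1, A y -> y <= m by rewrite /m; case: arg_maxnP.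
    have Apar (i : 'I_n.+1) : A i -> i < m -> A (par0 i).
      move=> Ai im; have [|_ /subsetP] := par0P i.
        by apply: leq_trans im _; rewrite -ltnS.
      apply; rewrite inE (Ai : v \in nth set0 L i) mem_bag_union; apply/hasP; exists (B m) => //.
      rewrite /B -(subnKC im) -nth_drop mem_nth // size_drop sL.
      by rewrite ltn_sub2r // (leq_ltn_trans im).
    have top i : A i -> connect (rel_in (parent_rel par0) A) i m.
      by move=> Ai; apply: parent_connect_top => //; apply: maxm.
    apply: (connect_trans (top s vs)).
    have symA : symmetric (rel_in (parent_rel par0) A).
      by move=> i j; rewrite /= parent_rel_sym [X in _ && X]andbC.
    by have := top t vt; rewrite (sym_connect_sym symA).
rewrite /treewidth; case: ex_minnP => w _ /(_ (width B)) minw.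
apply: leq_trans (minw _) _; first by apply/asboolP; exists (parent_tree par0), B.
rewrite /width -subn1 leq_subLR add1n; apply/bigmax_leqP=> i _.
by apply: (allP Lk); rewrite mem_nth ?sL.
Qed.

(** * Tree-width duality *)

Section Duality.
Variables (V E : finType) (inc : E -> {set V}) (K : nat).

(** A partition of [E] is a coloring [c : E -> nat]; its border consists of the
    vertices incident with two classes. *)
Definition border (c : E -> nat) : {set V} :=
  [set v | [exists e, [exists e', [&& v \in inc e, v \in inc e' & c e != c e']]]].

Lemma borderP c v : reflect (exists e e', [/\ v \in inc e, v \in inc e' & c e <> c e'])
  (v \in border c).
Proof.
rewrite inE; apply: (iffP existsP) => [[e /existsP[e' /and3P[? ? /eqP ?]]]|[e [e' [? ? /eqP ?]]]].
  by exists e, e'.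
by exists e; apply/existsP; exists e'; apply/and3P.
Qed.

Definition delta (A : {set E}) := border (fun e => e \in A).

Lemma deltaP (A : {set E}) v :
  reflect (exists e e', [/\ v \in inc e, v \in inc e', e \in A & e' \notin A])
  (v \in delta A).
Proof.
apply: (iffP (borderP _ _)) => [[e [e' [ve ve' cee]]]|[e [e' [ve ve' eA /negPf e'A]]]].
  move: cee; case eA: (e \in A); case e'A: (e' \in A) => // _; [exists e, e' | exists e', e];
    by rewrite ?eA ?e'A.
by exists e, e'; rewrite eA e'A.
Qed.

(** [splits N A]: the edge set [A] is the root side of a tree of partitions
    whose other leaves lie in [N] and whose nodes have border at most [K];
    the class of color [0] leads to the root. *)
Inductive splits (N : {set {set E}}) : {set E} -> Prop :=
| splits_leaf A : A \in N -> #|delta A| <= K -> splits N A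
| splits_node (c : E -> nat) : #|border c| <= K ->
    (forall i, 0 < i -> splits N [set e | c e == i]) ->
    splits N [set e | c e != 0].

Lemma splits_delta N A : splits N A -> #|delta A| <= K.
Proof.
case=> // c cK _; apply: leq_trans cK; apply/subset_leq_card/subsetP=> v.
case/deltaP=> e [e' [ve ve' ce ce']]; rewrite !inE ?negbK in ce ce'; move/eqP: ce' => ce'.
by apply/borderP; exists e, e'; split=> // cee; move: ce; rewrite cee ce'.
Qed.

Lemma splits_colors N A (c : E -> nat) : A = [set e | c e != 0] -> #|border c| <= K ->
  (forall i, 0 < i -> splits N [set e | c e == i]) -> splits N A.
Proof. by move=> ->; apply: splits_node. Qed.

Lemma splits0 (N : {set {set E}}) : set0 \in N -> splits N set0.
Proof.
move=> N0; apply: splits_leaf => //; rewrite (_ : delta _ = set0) ?cards0 //.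
by apply/setP=> v; rewrite in_set0; apply/deltaP=> -[e [e' []]]; rewrite inE.
Qed.

Lemma deltaC (A : {set E}) : delta (~: A) = delta A.
Proof.
by apply/setP=> v; apply/deltaP/deltaP=> -[e [e' [ve ve']]]; rewrite ?inE ?negbK => eA e'A;
  exists e', e; split; rewrite ?inE ?negbK.
Qed.

(** The two trees are joined at a node with classes [F] and [~: F], class 0 being empty. Every other
    positive color has an empty class, which must be a leaf. *)
Lemma splits_glue (N : {set {set E}}) (F : {set E}) : set0 \in N -> splits N F -> splits N (~: F) ->
  splits N [set: E].
Proof.
move=> N0 sF sCF; apply: (@splits_colors _ _ (fun e => if e \in F then 1 else 2)).
- by apply/setP=> e; rewrite !inE; case: (e \in F).
- apply: leq_trans (splits_delta sF); apply/subset_leq_card/subsetP=> v.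
  case/borderP=> e [e' [ve ve' cee]]; apply/borderP; exists e, e'; split=> //.
  by move: cee; case: (e \in F); case: (e' \in F).
move=> [|[|[|i]]] // _.
- by rewrite (_ : [set e | _] = F) //; apply/setP=> e; rewrite inE; case: (e \in F).
- by rewrite (_ : [set e | _] = ~: F) //; apply/setP=> e; rewrite !inE; case: (e \in F).
- rewrite (_ : [set e | _] = set0); first exact: splits0.
  by apply/setP=> e; rewrite !inE; case: (e \in F).
Qed.

(** Either the leaf [A] can be avoided, or the tree is turned around along the path from its root to
    [A]. The classes of a node are disjoint and [A] is nonempty, so only one child can need the leaf
    [A]. *)
Lemma splits_reroot (N : {set {set E}}) (A Z : {set E}) : set0 \in N -> A != set0 -> splits (A |: N) Z ->
  splits N Z \/ A \subset Z /\ (splits N (~: Z) -> splits N (~: A)).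
Proof.
move=> N0 A0; elim=> {Z} [Z|c cK _ IH].
  by rewrite in_setU1 => /predU1P[->|ZN] ZK; [right | left; apply: splits_leaf].
have [allN|] := pselect (forall i, 0 < i -> splits N [set e | c e == i]).
  by left; apply: splits_node.
move=> notN; right.
have [i [i0 [Ai sAi]]] : exists i, 0 < i /\ (A \subset [set e | c e == i] /\
    (splits N (~: [set e | c e == i]) -> splits N (~: A))).
  apply: contrapT => no; apply: notN => i i0.
  by case: (IH i i0) => // h; case: no; exists i.
split.
  by apply: subset_trans Ai _; apply/subsetP=> e; rewrite !inE => /eqP->; rewrite -lt0n.
move=> sZ; apply: sAi.
(* Exchanging colors 0 and [i] makes the child that holds [A] the direction of the root. *)
pose c' e := if c e == i then 0 else if c e == 0 then i else c e.
apply: (@splits_colors _ _ c').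
- apply/setP=> e; rewrite !inE /c'; case: (c e == i) => //.
  by have [_|->] := eqVneq (c e) 0; rewrite // -lt0n i0.
- apply: leq_trans cK; apply/subset_leq_card/subsetP=> v.
  case/borderP=> e [e' [ve ve' cee]]; apply/borderP; exists e, e'; split=> //.
  by move=> eqc; apply: cee; rewrite /c' eqc.
move=> j j0; have [->|ji] := eqVneq j i.
  rewrite (_ : [set e | _] = ~: [set e | c e != 0]) //; apply/setP=> e; rewrite !inE /c' negbK.
  case: (eqVneq (c e) i) => [->|ci]; first by rewrite eq_sym !gtn_eqF.
  by case: (eqVneq (c e) 0) => [|_]; [rewrite eqxx | rewrite (negPf ci)].
rewrite (_ : [set e | _] = [set e | c e == j]).
  case: (IH j j0) => // -[Aj _]; case/set0Pn: A0 => e eA.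
  have := subsetP Ai _ eA; have := subsetP Aj _ eA.
  by rewrite !inE => /eqP-> /eqP ji'; rewrite ji' eqxx in ji.
apply/setP=> e; rewrite !inE /c'.
case: (eqVneq (c e) i) => [->|ci]; first by rewrite eq_sym gtn_eqF // eq_sym (negPf ji).
case: (eqVneq (c e) 0) => [->|_] //.
by rewrite [i == j]eq_sym (negPf ji) eq_sym gtn_eqF.
Qed.

(** Uncrossing: restrict every class to [F]. By submodularity a border can grow by at most the
    excess of the border of [F] over that of [F :|: Y], where [Y] is the union of the nonzero
    classes, and minimality of [F] makes this excess at most zero. *)
Lemma splits_push (N : {set {set E}}) (A F Z : {set E}) :
  (forall X Y : {set E}, X \in N -> Y \subset X -> Y \in N) ->
  (forall F' : {set E}, F \subset F' -> F' \subset ~: A -> #|delta F| <= #|delta F'|) ->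
  F \subset ~: A -> Z \subset ~: A -> splits N Z -> splits N (Z :&: F).
Proof.
move=> downN minF FA ZA sZ.
have bound (c c' : E -> nat) (Y : {set E}) : Y \subset ~: A -> Y = [set e | c e != 0] ->
    (forall e, c' e = if e \in F then c e else 0) -> #|border c| <= K -> #|border c'| <= K.
  move=> YA YE c'E; apply: leq_trans.
  have le_delta : #|delta F| <= #|delta (F :|: Y)|.
    by apply: minF; rewrite ?subsetUl // subUset FA.
  rewrite -(leq_add2r #|delta F|) (leq_trans (leq_add (leqnn _) le_delta)) //.
  (* Submodularity is checked on the unions and on the intersections of the two borders
     separately. *)
  rewrite -(cardsUI (border c')) -(cardsUI (border c)); apply: leq_add; apply/subset_leq_card/subsetP=> v.
    apply: contraLR; rewrite !in_setU negb_or => /andP[vc vF].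
    have same e e' : v \in inc e -> v \in inc e' -> c e = c e' /\ (e \in F) = (e' \in F).
      by move=> ve ve'; split; apply: contrapT => h; [case/borderP: vc | case/borderP: vF];
        exists e, e'; split=> // he; apply: h; move: he; case: (e \in F); case: (e' \in F).
    rewrite negb_or; apply/andP; split; apply/negP.
      by case/borderP=> e [e' [ve ve']]; rewrite !c'E; have [-> ->] := same _ _ ve ve'.
    case/deltaP=> e [e' [ve ve']]; rewrite YE !inE.
    by have [-> ->] := same _ _ ve ve' => ->.
  case/setIP=> /borderP[e1 [e2 [v1 v2 c12]]] /deltaP[_ [b [_ vb _ bFY]]].
  have /andP[bF /eqP cb] : (b \notin F) && (c b == 0).
    by move: bFY; rewrite YE !inE negb_or negbK.
  have [e [ve eF ce]] : exists e, [/\ v \in inc e, e \in F & c e <> 0].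
    move: c12; rewrite !c'E; case e1F: (e1 \in F); case e2F: (e2 \in F) => // c12.
    - have [c10|/eqP] := eqVneq (c e1) 0; last by exists e1.
      by exists e2; split=> // c20; apply: c12; rewrite c10.
    - by exists e1; split.
    - by exists e2; split=> // c20; apply: c12; rewrite c20.
  rewrite in_setI; apply/andP; split; last by apply/deltaP; exists e, b.
  by apply/borderP; exists e, b; rewrite cb.
elim: sZ ZA => {Z} [Z ZN ZK|c cK _ IH] ZA.
  apply: splits_leaf; first by apply: downN ZN (subsetIl _ _).
  apply: (bound (fun e => e \in Z) _ Z ZA _ _ ZK) => [|e].
    by apply/setP=> e; rewrite inE eqb0 negbK.
  by rewrite inE; case: (e \in F); rewrite ?andbT ?andbF.
apply: (@splits_colors _ _ (fun e => if e \in F then c e else 0)).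
- by apply/setP=> e; rewrite !inE; case: (e \in F); rewrite ?andbT ?andbF.
- exact: (bound c _ _ ZA _ _ cK).
move=> i i0; rewrite (_ : [set e | _] = [set e | c e == i] :&: F).
  apply: IH => //; apply: subset_trans ZA; apply/subsetP=> e.
  by rewrite !inE => /eqP->; rewrite -lt0n.
apply/setP=> e; rewrite !inE; case: (e \in F); rewrite ?andbT ?andbF //.
by rewrite eq_sym gtn_eqF.
Qed.

Section Bramble.
Let small : {set {set E}} := [set A : {set E} | #|A| <= 1].

(** The complement of a maximal leaf family that admits no tree. *)
Lemma bramble_exists : ~ splits small [set: E] -> exists Br : {set {set E}},
  [/\ forall A B, A \in Br -> B \in Br -> A :&: B != set0,
      forall A, A \in Br -> 1 < #|A|
    & forall c : E -> nat, #|border c| <= K -> exists i, [set e | c e == i] \in Br].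
Proof.
move=> no_small.
pose down (N : {set {set E}}) := forall X Y : {set E}, X \in N -> Y \subset X -> Y \in N.
pose ok (N : {set {set E}}) := [/\ small \subset N, down N & ~ splits N [set: E]].
have [N [[sN dN noN] maxN]] : exists N, ok N /\ forall N', ok N' -> N \subset N' -> N' = N.
  pose okb (N : {set {set E}}) := `[< ok N >].
  have : okb small.
    apply/asboolP; split=> // X Y; rewrite !inE => X1 /subset_leq_card YX.
    exact: leq_trans X1.
  case/maxset_exists=> N /maxsetP[/asboolP okN maxN] _; exists N; split=> // N' okN' NN'.
  by apply: maxN => //; apply/asboolP.
have N0 : set0 \in N by apply: (subsetP sN); rewrite inE cards0.
(* Take [F] of least border between [B] and [~: A]. The tree for [~: A] is pushed onto [F], the tree
   for [~: B] onto [~: F], and the two are glued. *)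
have bad_push (A B : {set E}) : A \in ~: N -> B \in ~: N -> A :&: B = set0 ->
    splits N (~: A) -> splits N (~: B) -> splits N [set: E].
  move=> _ _ AB sA sB.
  pose range (F : {set E}) := (B \subset F) && (F \subset ~: A).
  have rB : range B by rewrite /range subxx -disjoints_subset -setI_eq0 setIC AB /=.
  pose F := [arg min_(F' < B | range F') #|delta F'|].
  have [/andP[BF FA] minF] : range F /\ forall F', range F' -> #|delta F| <= #|delta F'|.
    by rewrite /F; case: arg_minnP.
  apply: (@splits_glue _ F) => //.
    rewrite -(setIidPr FA); apply: (@splits_push _ A) => // F' FF' F'A.
    by apply: minF; rewrite /range (subset_trans BF FF').
  have CF : ~: F \subset ~: B by rewrite setCS.
  rewrite -(setIidPr CF); apply: (@splits_push _ B) => // F' FF' F'B.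
  rewrite deltaC -(deltaC F'); apply: minF; apply/andP; split.
    by rewrite -[B]setCK setCS.
  by rewrite setCS (subset_trans _ FF') // -[A]setCK setCS.
(* Adding a minimal non-member [A'] keeps the family closed under subsets, so by maximality a tree
   appears. It must use the leaf [A'], and rerooting there yields a tree for the complement. *)
have min_bad (A : {set E}) : A \notin N -> exists A' : {set E}, [/\ A' \subset A, A' \notin N & splits N (~: A')].
  move=> AN; have [A' /minsetP[A'N minA'] A'A] := minset_exists (P := fun X : {set E} => X \notin N) AN.
  exists A'; split=> //.
  have A'0 : A' != set0 by apply: contraNneq A'N => ->.
  have : splits (A' |: N) [set: E].
    apply: contrapT => nos; suff : A' |: N = N by move/setP/(_ A'); rewrite setU11 (negPf A'N).
    apply: maxN (subsetUr _ _); split=> //; first exact: subset_trans sN (subsetUr _ _).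
    move=> X Y; rewrite !in_setU1 => /predU1P[->|XN] YX; last by rewrite (dN X) ?orbT.
    have [//|YN /=] := boolP (Y \in N); first by rewrite orbT.
    by rewrite orbF; apply/eqP; apply: minA'.
  case/(splits_reroot N0 A'0) => // -[_]; apply; rewrite setCT; exact: splits0.
exists (~: N); split.
- move=> A B; rewrite !inE => AN BN; apply/eqP=> AB; apply: noN.
  have [A' [A'A A'N sA']] := min_bad A AN; have [B' [B'B B'N sB']] := min_bad B BN.
  apply: (@bad_push A' B') => //; rewrite ?inE //; apply/eqP; rewrite -subset0 -AB.
  exact: setISS.
- by move=> A; rewrite inE ltnNge; apply: contra => A1; apply: (subsetP sN); rewrite inE.
- move=> c cK; apply: contrapT => no; apply: noN.
  (* Shifting the colors empties class 0, so this node splits all of [E]; if every class lay in [N],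
     its children would be leaves. *)
  apply: (@splits_colors _ _ (fun e => (c e).+1)).
  + by apply/setP=> e; rewrite !inE.
  + apply: leq_trans cK; apply/subset_leq_card/subsetP=> v.
    by case/borderP=> e [e' [ve ve' cee]]; apply/borderP; exists e, e'; split=> // h; apply: cee; rewrite h.
  move=> [//|i] _; apply: splits_leaf.
    apply: contrapT => h; apply: no; exists i; rewrite inE; exact/negP.
  apply: leq_trans cK; apply/subset_leq_card/subsetP=> v /deltaP[e [e' [ve ve' ce ce']]].
  rewrite !inE !eqSS in ce ce'; move/eqP: ce => ce; move/eqP: ce' => ce'; apply/borderP; exists e, e'; split=> //.
  by rewrite ce => ce''; apply: ce'.
Qed.

End Bramble.
End Duality.

(** Reads bags off a tree of partitions: a node yields its border, a leaf the ends of its edge. [b]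
    is the parent bag. By the last hypothesis, vertices of [A] already covered lie in [b] and on the
    border of [A], which confines the overlap of each new bag to its parent. *)
Lemma splits_bags (V E : finType) (inc : E -> {set V}) K (A : {set E}) :
  (forall e, #|inc e| <= K) ->
  splits inc K [set X : {set E} | #|X| <= 1] A ->
  forall (L : seq {set V}) (b : {set V}), valid_bags L ->
  all (fun c : {set V} => #|c| <= K) L -> b \in L ->
  (forall v e, v \in bag_union L -> e \in A -> v \in inc e ->
     v \in b /\ exists2 e', e' \notin A & v \in inc e') ->
  exists L', [/\ valid_bags L', all (fun c : {set V} => #|c| <= K) L', {subset L <= L'},
    forall v, v \in bag_union L' ->
      v \in bag_union L \/ exists2 e, e \in A & v \in inc e
    & forall e, e \in A -> exists2 c, c \in L' & inc e \subset c].
Proof.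
move=> incK; elim=> {A} [A|c cK _ IH]; last first.
  move=> L b vL LK bL hb; set A := [set e | c e != 0] in hb *.
  pose L1 := border inc c :: L.
  have vL1 : valid_bags L1.
    rewrite /= vL; apply/orP; right; apply/hasP; exists b => //.
    apply/subsetP=> v /setIP[/borderP[e [e' [ve ve' cee]]] vL'].
    have [ce0|ce0] := eqVneq (c e) 0.
      have [|//] := hb v e' vL' _ ve'; rewrite inE; apply/eqP=> ce'0.
      by apply: cee; rewrite ce0.
    by have [|//] := hb v e vL' _ ve; rewrite inE.
  have [m maxm] : exists m, forall e, c e <= m.
    by exists (\max_e c e) => e; apply: leq_bigmax.
  (* The children are added color by color, the claim for [m] covering the colors from 1 to [m]. *)
  suff [L' [vL' LK' sL' uL' cL']] : exists L' : seq {set V}, [/\ valid_bags L',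
      all (fun c : {set V} => #|c| <= K) L', {subset L1 <= L'},
      forall v, v \in bag_union L' ->
        v \in bag_union L1 \/ exists2 e, 0 < c e <= m & v \in inc e
      & forall e, 0 < c e <= m -> exists2 c, c \in L' & inc e \subset c].
    exists L'; split=> // [x xL|v /uL'|e]; first by apply: sL'; rewrite in_cons xL orbT.
      rewrite /bag_union big_cons inE => -[/orP[|]|[e /andP[ce _] ve]]; last 1 first.
      - by right; exists e; rewrite // inE -lt0n.
      - case/borderP=> e [e' [ve ve' cee]]; right.
        have [ce0|ce0] := eqVneq (c e) 0; last by exists e; rewrite // inE.
        by exists e'; rewrite // inE -ce0; apply/eqP=> h; apply: cee.
      - by left.
    by rewrite inE -lt0n => ce; apply: cL'; rewrite ce maxm.
  elim: (m) => [|n [L' [vL' LK' sL' uL' cL']]].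
    exists L1; split=> // [|v|e]; first by rewrite /= cK LK.
      by left.
    by rewrite leqn0 lt0n; case: (c e == 0).
  have bL' : border inc c \in L' by apply: sL'; apply: mem_head.
  have [v e vu|L2 [vL2 LK2 sL2 uL2 cL2]] := IH n.+1 isT L' (border inc c) vL' LK' bL'.
    rewrite inE => /eqP ce ve.
    suff [e' [ve' ce']] : exists e', v \in inc e' /\ c e' != n.+1.
      split; last by exists e'; rewrite // inE.
      apply/borderP; exists e, e'; split=> // h; by rewrite -h ce eqxx in ce'.
    case: (uL' v vu) => [|[e0 /andP[_ ce0] ve0]]; last first.
      by exists e0; split=> //; rewrite neq_ltn ltnS ce0.
    rewrite /bag_union big_cons inE => /orP[/borderP[e1 [e2 [v1 v2 c12]]]|vuL].
      have [c1|c1] := eqVneq (c e1) n.+1; last by exists e1.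
      by exists e2; split=> //; rewrite -c1; apply/eqP=> h; apply: c12.
    have [|_ [e' e'A ve']] := hb v e vuL _ ve; first by rewrite inE ce.
    by exists e'; split=> //; move: e'A; rewrite inE negbK => /eqP->.
  exists L2; split=> // [x /sL'/sL2 //|v /uL2[/uL'[|[e /andP[c0 cn] ve]]|[e]]|e].
  - by left.
  - by right; exists e; rewrite // c0 leqW.
  - by rewrite inE => /eqP ce ve; right; exists e; rewrite // ce /=.
  - rewrite [c e <= _]leq_eqVlt ltnS => /andP[c0 /orP[/eqP ce|cn]].
      by apply: cL2; rewrite inE ce.
    by have [x /sL2 xL ex] := cL' e (introT andP (conj c0 cn)); exists x.
rewrite inE => A1 _ L b vL LK bL hb.
have [A0|/set0Pn[e eA]] := eqVneq A set0.
  by exists L; split=> // [v|e]; [left | rewrite A0 inE].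
have AE e' : e' \in A -> e' = e by move=> e'A; apply: (card_le1_eqP A1).
exists (inc e :: L); split=> [||x xL|v|e' /AE->].
- rewrite /= vL; apply/orP; right; apply/hasP; exists b => //.
  by apply/subsetP=> v /setIP[ve vL']; have [] := hb v e vL' eA ve.
- by rewrite /= incK.
- by rewrite in_cons xL orbT.
- by rewrite /bag_union big_cons inE => /orP[ve|]; [right; exists e | left].
- by exists (inc e); rewrite ?mem_head.
Qed.

(** * Havens from brambles *)

Section Haven.
Variables (H : sgraph) (k : nat).
Hypotheses (k0 : 0 < k) (twH : k < treewidth H).

(** Loops are added so that isolated vertices are covered as well. *)
Let arc := {p : H * H | (p.1 == p.2) || (p.1 -- p.2)}.
Let inc (e : arc) : {set H} := [set (val e).1; (val e).2].

Let incK e : #|inc e| <= k.+1.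
Proof. by rewrite /inc cards2; case: (_ == _); rewrite ?ltnS. Qed.

Let no_split : ~ splits inc k.+1 [set X : {set arc} | #|X| <= 1] [set: arc].
Proof.
move=> sT; have [||||L [vL LK sL _ cL]] := splits_bags incK sT (L := [:: set0]) (b := set0).
- by [].
- by rewrite /= cards0.
- exact: mem_head.
- by move=> v e; rewrite mem_bag_union /= inE.
move: twH; rewrite ltnNge => /negP; apply.
apply: (@valid_treewidth _ L) => //.
- by apply: contraTneq (sL set0 (mem_head _ _)) => ->.
- move=> v; have vv : (v == v) || (v -- v) by rewrite eqxx.
  have [b bL /subsetP sb] := cL (Sub (v, v) vv) (in_setT _); exists b => //.
  by apply: sb; rewrite !inE eqxx.
- move=> v w vw; have e : (v == w) || (v -- w) by rewrite vw orbT.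
  have [b bL /subsetP sb] := cL (Sub (v, w) e) (in_setT _); exists b => //.
  by rewrite !sb // !inE eqxx ?orbT.
Qed.

Definition avoiding (X : {set H}) := rel_in (@sedge H) [pred v | v \notin X].

Lemma avoiding_sym X : connect_sym (avoiding X).
Proof. by apply: sym_connect_sym => x y; rewrite /= sedge_sym [X in _ && X]andbC. Qed.

Let region (X : {set H}) (r : H) : {set arc} :=
  [set e | [exists v, [&& v \in inc e, v \notin X & connect (avoiding X) r v]]].

Let arc_avoiding (X : {set H}) (e : arc) v w : v \in inc e -> w \in inc e ->
  v \notin X -> w \notin X -> connect (avoiding X) v w.
Proof.
case: e => -[a b] /= ab; rewrite !inE /= => vab wab vX wX.
have [->|vw] := eqVneq v w; first exact: connect0.
apply: connect1; rewrite /= vX wX !andbT.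
move: vab wab ab vw => /orP[/eqP->|/eqP->] /orP[/eqP->|/eqP->]; rewrite ?eqxx //= => /orP[/eqP->|//].
- by rewrite eqxx.
- by rewrite eqxx.
- by rewrite sedge_sym.
Qed.

(** Color the arcs by the component of [H] minus [X] that they touch, arcs inside [X] each
    separately. The border lies in [X], so some class is in the bramble; it has at least two arcs,
    hence belongs to a component, the choice at [X]. *)
Lemma haven_exists : exists beta : {set H} -> pred H, [/\
  forall X : {set H}, #|X| <= k.+1 -> exists r, beta X r,
  forall (X : {set H}) r, beta X r -> r \notin X,
  forall X r r', beta X r -> beta X r' -> connect (avoiding X) r r'
  & forall (X Y : {set H}) r, X \subset Y -> #|Y| <= k.+1 -> beta Y r -> beta X r].
Proof.
have [Br [meet big hit]] := bramble_exists no_split.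
pose beta (X : {set H}) r := (r \notin X) && (region X r \in Br).
have beta1 (X : {set H}) : #|X| <= k.+1 -> exists r, beta X r.
  move=> XK.
  pose comp (e : arc) := if [pick v in inc e | v \notin X] is Some v
    then [set w | connect (avoiding X) v w] else set0.
  (* Pickling turns arcs and components into natural numbers, and the sum type keeps the two kinds
     apart. *)
  pose c (e : arc) := if inc e \subset X then choice.pickle (inl e : arc + {set H})
    else choice.pickle (inr (comp e) : arc + {set H}).
  have [|i iBr] := hit c.
    apply: leq_trans XK; apply/subset_leq_card/subsetP=> v /borderP[e [e' [ve ve' cee]]].
    apply: contrapT => /negP vX; apply: cee; rewrite /c.
    have nX (f : arc) : v \in inc f -> (inc f \subset X) = false.
      by move=> vf; apply/negbTE/subsetPn; exists v.
    rewrite !nX //; congr (choice.pickle (inr _)).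
    have compE (f : arc) : v \in inc f -> comp f = [set w | connect (avoiding X) v w].
      move=> vf; rewrite /comp; case: pickP => [u /andP[uf uX]|/(_ v)]; last by rewrite /= vf vX.
      apply/setP=> w; rewrite !inE; apply: (same_connect (@avoiding_sym X)).
      exact: arc_avoiding uf vf uX vX.
    by rewrite !compE.
  have /card_gt0P[e] : 0 < #|[set e | c e == i]| by apply: ltnW; apply: big.
  rewrite inE => /eqP ce.
  have [eX|eX] := boolP (inc e \subset X).
    have := big _ iBr; suff -> : [set e | c e == i] = [set e] by rewrite cards1.
    apply/setP=> f; rewrite !inE -ce /c eX; case: ifP => fX.
      by rewrite (inj_eq (pcan_inj choice.pickleK)).
    rewrite (inj_eq (pcan_inj choice.pickleK)) ; case: (eqVneq f e) => // fe.
    by rewrite -fe fX in eX.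
  case/subsetPn: (eX) => r re rX; exists r; rewrite /beta rX /=.
  suff -> : region X r = [set e | c e == i] by [].
  have compE (f : arc) v : v \in inc f -> v \notin X -> comp f = [set w | connect (avoiding X) v w].
    move=> vf vX; rewrite /comp; case: pickP => [u /andP[uf uX]|/(_ v)]; last by rewrite /= vf vX.
    apply/setP=> w; rewrite !inE; apply: (same_connect (@avoiding_sym X)).
    exact: arc_avoiding uf vf uX vX.
  apply/setP=> f; rewrite !inE -ce /c (negPf eX); case: ifP => [fX|/negbT/subsetPn[v vf vX]].
    rewrite (inj_eq (pcan_inj choice.pickleK)) /=; apply/existsP=> -[v /and3P[vf /negP vX _]].
    by apply: vX; apply: (subsetP fX).
  rewrite (inj_eq (pcan_inj choice.pickleK)) (inj_eq (@inr_inj _ _)) (compE f v) // (compE e r) //.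
  apply/existsP/eqP => [[u /and3P[uf uX ru]]|/setP/(_ r)]; last first.
    by rewrite !inE connect0 avoiding_sym => rv; exists v; apply/and3P.
  apply/setP=> w; rewrite !inE; apply: (same_connect (@avoiding_sym X)).
  by apply: connect_trans (arc_avoiding vf uf vX uX) _; rewrite avoiding_sym.
(* An arc common to the two regions links their components, and a path avoiding [Y] also avoids
   [X]. *)
have meetE (X Y : {set H}) r r' : X \subset Y -> beta X r -> beta Y r' -> connect (avoiding X) r r'.
  move=> XY /andP[_ rB] /andP[_ r'B]; case/set0Pn: (meet _ _ rB r'B) => e.
  rewrite !inE => /andP[/existsP[v /and3P[ve vX rv]] /existsP[w /and3P[we wY r'w]]].
  have wX : w \notin X by apply: contra wY; apply: (subsetP XY).
  apply: connect_trans rv _; apply: connect_trans (arc_avoiding ve we vX wX) _.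
  rewrite avoiding_sym; apply: connect_sub r'w => a b /= /and3P[ab aY bY].
  apply: connect1; rewrite /= ab.
  by rewrite (contra (subsetP XY a)) // (contra (subsetP XY b)).
exists beta; split=> // [X r /andP[]|X r r'|X Y r XY YK bY] //.
  exact: meetE.
have [r0 br0] := beta1 X (leq_trans (subset_leq_card XY) YK).
have r0r := meetE X Y r0 r XY br0 bY; have [_ r0B] := andP br0; have [rY _] := andP bY.
rewrite /beta (contra (subsetP XY r)) //= -(_ : region X r0 = region X r) //.
apply/setP=> e; rewrite !inE; apply: eq_existsb => v; congr [&& _, _ & _].
exact: (same_connect (@avoiding_sym X)).
Qed.

End Haven.

(** * Cai-Fuerer-Immerman graphs *)

Section CFI.
Variable H : sgraph.
(** Labels are total on [H] rather than on the neighbors of a vertex, which avoids dependent types;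
    each usual vertex then appears as a class of twins. *)
Notation labels := {ffun H -> bool}.

Definition parity (v : H) (S : labels) := \big[addb/false]_(u | v -- u) S u.

Definition xor_labels (S T : labels) : labels := [ffun u => S u (+) T u].

Lemma parity_xor v S T : parity v (xor_labels S T) = parity v S (+) parity v T.
Proof. by rewrite /parity -big_split; apply: eq_bigr => u _; rewrite ffunE. Qed.

Lemma xor_labelsK T : involutive (xor_labels^~ T).
Proof. by move=> S; apply/ffunP=> u; rewrite !ffunE addbK. Qed.

Definition label0 : labels := [ffun _ => false].

Lemma parity0 v : parity v label0 = false.
Proof. by rewrite /parity big1 // => u _; rewrite ffunE. Qed.

Lemma parity1 v a : parity v [ffun u => u == a] = v -- a.
Proof.
rewrite /parity; case va: (v -- a); last first.
  by rewrite big1 // => u vu; rewrite ffunE; apply: contraTF vu => /eqP->; rewrite va.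
rewrite (bigD1 a) //= ffunE eqxx big1 // => u /andP[_ /negPf]; by rewrite ffunE.
Qed.

(** Cai-Fuerer-Immerman graph over [H], twisted at the vertices in [U]; a
    vertex [(v, S)] labels by [S u] the edges [v -- u]. *)
Definition cfi_vertex (U : {set H}) :=
  {p : H * labels | parity p.1 p.2 == (p.1 \in U)}.

Definition cfi_rel (U : {set H}) : rel (cfi_vertex U) :=
  fun p q => ((val p).1 -- (val q).1) && ((val p).2 (val q).1 == (val q).2 (val p).1).

Lemma cfi_sym U : symmetric (@cfi_rel U).
Proof. by move=> p q; rewrite /cfi_rel sedge_sym eq_sym. Qed.

Lemma cfi_irr U : irreflexive (@cfi_rel U).
Proof. by move=> p; rewrite /cfi_rel sedge_irr. Qed.

Definition cfi (U : {set H}) := SGraph (@cfi_sym U) (@cfi_irr U).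

Definition cfi_base U (p : cfi U) : H := (val p).1.

(** Such a [D] amounts to a set of edges of [H] whose labels are to be flipped. *)
Definition symmetric_labels (D : H -> labels) := forall v u, v -- u -> D v u = D u v.

(** Flipping the edges of a path moves a twist from one end to the other: inner vertices meet the
    path evenly, and vertices of [X] not at all. *)
Lemma path_labels (X : {set H}) r r' : connect (avoiding X) r r' ->
  exists D : H -> labels, [/\ symmetric_labels D,
    forall v, v \in X -> D v = label0
    & forall v, parity v (D v) = (v == r) (+) (v == r')].
Proof.
case/connectP=> q; elim: q r => [|x q IHq] r /=.
  move=> _ ->; exists (fun=> label0); split=> [v u _|v _|v]; rewrite ?ffunE ?parity0 ?addbb //.
case/andP=> /and3P[rx rX xX] pq /(IHq _ pq)[D [symD XD parD]].
pose D1 v : labels := if v == r then [ffun u => u == x] else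
  if v == x then [ffun u => u == r] else label0.
have rx' : (x == r) = false by apply: contraTF rx => /eqP->; rewrite sedge_irr.
have D1E v u : D1 v u = (v == r) && (u == x) || (v == x) && (u == r).
  rewrite /D1; case: (eqVneq v r) => [->|_]; first by rewrite ffunE [r == x]eq_sym rx' orbF.
  by case: (v == x); rewrite ffunE.
exists (fun v => xor_labels (D1 v) (D v)); split=> [v u vu|v vX|v].
- by rewrite !ffunE symD // !D1E orbC andbC [X in _ || X]andbC.
- rewrite XD //; apply/ffunP=> u; rewrite !ffunE D1E.
  have -> : (v == r) = false by apply: contraTF vX => /eqP->.
  by have -> : (v == x) = false by apply: contraTF vX => /eqP->.
- rewrite parity_xor parD addbA; congr (_ (+) _); rewrite /D1.
  case: (eqVneq v r) => [->|vr]; first by rewrite parity1 rx [r == x]eq_sym rx'.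
  case: (eqVneq v x) => [->|vx]; first by rewrite parity1 sedge_sym rx.
  by rewrite parity0.
Qed.

Section CFIGame.
Variables (k : nat) (beta : {set H} -> pred H) (u0 : H).
Hypothesis beta_ex : forall X : {set H}, #|X| <= k.+1 -> exists r, beta X r.
Hypothesis beta_notin : forall (X : {set H}) r, beta X r -> r \notin X.
Hypothesis beta_conn : forall (X : {set H}) r r', beta X r -> beta X r' ->
  connect (avoiding X) r r'.
Hypothesis beta_sub : forall (X Y : {set H}) r, X \subset Y -> #|Y| <= k.+1 ->
  beta Y r -> beta X r.
Hypothesis beta_u0 : beta set0 u0.

Notation G0 := (cfi set0).
Notation G1 := (cfi [set u0]).

Definition pebbled (s : seq (G0 * G1)) : {set H} := [set v in [seq cfi_base p.1 | p <- s]].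

Definition twist (D : H -> labels) (p : H * labels) := (p.1, xor_labels p.2 (D p.1)).

(** Duplicator keeps the twist at a vertex [r] of the haven of the pebbled
    vertices. *)
Definition cfi_winning (s : seq (G0 * G1)) := size s <= k.+1 /\
  exists D r, [/\ symmetric_labels D, beta (pebbled s) r,
    forall v, parity v (D v) = (v == u0) (+) (v == r)
    & forall p, p \in s -> val p.2 = twist D (val p.1)].

Lemma card_pebbled s : #|pebbled s| <= size s.
Proof. by rewrite cardsE (leq_trans (card_size _)) // size_map. Qed.

Lemma twistK D : involutive (twist D).
Proof. by case=> v S; rewrite /twist /= xor_labelsK. Qed.

(** The bijection is fixed before the pebbled vertex is known, but it preserves base vertices, so it
    may be chosen over each [v] separately. There the twist is first moved, avoiding the pebbles,
    into the haven of the pebbled vertices together with [v]; it then sits away from [v]. *)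
Lemma cfi_game : game k cfi_winning.
Proof.
split.
- split=> //; exists (fun=> label0), u0; split=> [v u _||v|//].
  + by rewrite !ffunE.
  + by rewrite (_ : pebbled [::] = set0) //; apply/setP=> v; rewrite !inE.
  + by rewrite parity0 addbb.
- move=> s [_ [D [r [symD br parD sD]]]] sk.
  have cardX v : #|v |: pebbled s| <= k.+1.
    rewrite (leq_trans (leq_card_setU _ _)) // cards1 add1n ltnS.
    exact: leq_trans (card_pebbled s) sk.
  have /choice[E EP] : forall v, exists E : (H -> labels) * H,
      [/\ symmetric_labels E.1, beta (v |: pebbled s) E.2,
          forall w, parity w (E.1 w) = (w == u0) (+) (w == E.2)
        & forall w, w \in pebbled s -> E.1 w = D w].
    move=> v; have [r' br'] := beta_ex (cardX v).
    have br'X : beta (pebbled s) r' by apply: beta_sub br'; rewrite ?subsetUr.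
    have [D1 [symD1 XD1 parD1]] := path_labels (beta_conn br br'X).
    exists (fun w => xor_labels (D w) (D1 w), r'); split=> //= [w u wu|w|w wX].
    + by rewrite !ffunE symD // symD1.
    + by rewrite parity_xor parD parD1 addbA addbK.
    + by rewrite XD1 //; apply/ffunP=> u; rewrite !ffunE addbF.
  (* Applied in both directions: over each base vertex the twist is an involution, which yields the
     bijection and its inverse. *)
  have EU (U U' : {set H}) (w : cfi U) : (forall v, (v \in U) (+) (v \in U') = (v == u0)) ->
      exists w' : cfi U', val w' = twist (E (cfi_base w)).1 (val w).
    move=> UU'; set v := cfi_base w; set S := (val w).2.
    have /eqP pS : parity v S == (v \in U) := valP w.
    have [_ bE parE _] := EP v.
    have vE : (v == (E v).2) = false.
      by apply: contraTF (beta_notin bE) => /eqP<-; rewrite negbK setU11.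
    have pT : parity v (xor_labels S ((E v).1 v)) == (v \in U').
      by rewrite parity_xor pS parE vE addbF -UU' addKb.
    by exists (Sub (v, xor_labels S ((E v).1 v)) pT).
  have /choice[b bE] : forall w : G0, exists w' : G1, val w' = twist (E (cfi_base w)).1 (val w).
    by move=> w; apply: EU => v; rewrite !inE.
  have /choice[c cE] : forall w : G1, exists w' : G0, val w' = twist (E (cfi_base w)).1 (val w).
    by move=> w; apply: EU => v; rewrite !inE addbF.
  exists b.
    exists c => w; apply: val_inj.
      by rewrite cE bE /cfi_base bE /= twistK.
    by rewrite bE cE /cfi_base cE /= twistK.
  move=> w; split; first by rewrite /= ltnS.
  have [symE bEr parE XE] := EP (cfi_base w).
  exists (E (cfi_base w)).1, (E (cfi_base w)).2; split=> // [|p].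
    by rewrite (_ : pebbled _ = cfi_base w |: pebbled s) //; apply/setP=> v; rewrite !inE.
  rewrite in_cons => /predU1P[->|ps]; first by rewrite bE.
  rewrite sD // /twist XE // inE; apply/mapP; by exists p.
- move=> s t [sk [D [r [symD br parD sD]]]] tk ts; split=> //.
  exists D, r; split=> // [|p /ts]; last exact: sD.
  apply: beta_sub br; last exact: leq_trans (card_pebbled s) sk.
  apply/subsetP=> v; rewrite !inE => /mapP[p /ts ps ->]; exact: map_f.
- move=> s p q [_ [D [r [symD _ _ sD]]]] /sD p2 /sD q2; split.
    by rewrite -!val_eqE p2 q2 (inj_eq (can_inj (@twistK D))).
  rewrite [LHS]/(cfi_rel p.1 q.1) [RHS]/(cfi_rel p.2 q.2) /cfi_rel p2 q2 /=.
  case pq: (_ -- _) => //=; rewrite !ffunE (symD _ _ pq).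
  by rewrite -!negb_add addbACA addbb addbF.
Qed.

Lemma cfi_winning_base s p : cfi_winning s -> p \in s -> cfi_base p.1 = cfi_base p.2.
Proof. by case=> _ [D [r [_ _ _ sD]]] /sD; rewrite /cfi_base => ->. Qed.
End CFIGame.
End CFI.

(** * Embeddings and subgraph counts *)

Definition embs (F G : sgraph) : {set {ffun F -> G}} :=
  [set f in homs F G | injectiveb f].

Lemma embsP (F G : sgraph) (f : {ffun F -> G}) :
  reflect ((forall x y, x -- y -> f x -- f y) /\ injective f) (f \in embs F G).
Proof. by rewrite inE; apply: (iffP andP) => -[/homsP h /injectiveP i]; split. Qed.

Lemma card_fibers (A B : finType) (h : A -> B) (D : {set A}) :
  #|D| = \sum_(b : B) #|[set x in D | h x == b]|.
Proof.
rewrite -sum1_card (partition_big h predT) //=; apply: eq_bigr => b _.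
by rewrite -sum1_card; apply: eq_bigl => x; rewrite inE.
Qed.

Section Kernel.
Variable F : sgraph.

(** A partition of [F] encoded by one chosen representative per fiber; the choice depends only on
    the fiber, so equal partitions give equal kernels. *)
Definition ker (T : eqType) (f : {ffun F -> T}) : {ffun F -> F} :=
  [ffun x => odflt x [pick y | f y == f x]].

Lemma ker_val (T : eqType) (f : {ffun F -> T}) x : f (ker f x) = f x.
Proof. by rewrite ffunE; case: pickP => //= y /eqP. Qed.

Lemma ker_eq (T : eqType) (f : {ffun F -> T}) x y : (ker f x == ker f y) = (f x == f y).
Proof.
apply/eqP/eqP=> [e|e]; first by rewrite -ker_val e ker_val.
rewrite !ffunE; under eq_pick do rewrite e.
by case: pickP => // /(_ y); rewrite eqxx.
Qed.

Lemma ker_ext (T T' : eqType) (f : {ffun F -> T}) (g : {ffun F -> T'}) :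
  (forall x y, (f x == f y) = (g x == g y)) -> ker f = ker g.
Proof.
by move=> fg; apply/ffunP=> x; rewrite !ffunE; congr odflt; apply: eq_pick => y; rewrite fg.
Qed.

Lemma ker_idem (T : eqType) (f : {ffun F -> T}) : ker (ker f) = ker f.
Proof. by apply: ker_ext => x y; rewrite ker_eq. Qed.

Lemma ker_id_inj (T : eqType) (f : {ffun F -> T}) : (ker f == finfun id) = injectiveb f.
Proof.
apply/eqP/injectiveP => [/ffunP e x y fxy|f_inj].
  by have := ker_eq f x y; rewrite !e !ffunE fxy eqxx => /eqP.
by apply/ffunP=> x; rewrite [RHS]ffunE; apply: f_inj; apply: ker_val.
Qed.

Variable r : {ffun F -> F}.

Definition quotient_rel : rel {x : F | x \in codom r} := fun x y =>
  (x != y) && [exists a, [exists b, [&& a -- b, r a == val x & r b == val y]]].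

Lemma quotient_sym : symmetric quotient_rel.
Proof.
move=> x y; rewrite /quotient_rel eq_sym; congr (_ && _).
by apply/existsP/existsP=> -[a /existsP[b /and3P[ab ra rb]]]; exists b; apply/existsP; exists a;
  rewrite sedge_sym ab ra rb.
Qed.

Lemma quotient_irr : irreflexive quotient_rel.
Proof. by move=> x; rewrite /quotient_rel eqxx. Qed.

Definition quotient := SGraph quotient_sym quotient_irr.

Hypothesis r_ker : ker r = r.
Hypothesis r_loopless : forall a b, a -- b -> r a != r b.

Definition quotient_class x : quotient := Sub (r x) (codom_f r x).

Lemma quotient_classE (x : quotient) : exists a, x = quotient_class a.
Proof. by case: x => z /[dup] /codomP[a ->] az; exists a; apply: val_inj. Qed.

Lemma quotient_edge a b : a -- b -> quotient_class a -- quotient_class b.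
Proof.
move=> ab; apply/andP; split; first by rewrite -val_eqE /= r_loopless.
by apply/existsP; exists a; apply/existsP; exists b; rewrite ab !eqxx.
Qed.

Lemma quotient_edgeE (x y : quotient) : x -- y ->
  exists a b, [/\ a -- b, x = quotient_class a & y = quotient_class b].
Proof.
case/andP=> _ /existsP[a /existsP[b /and3P[ab /eqP ra /eqP rb]]].
by exists a, b; split=> //; apply: val_inj; rewrite /= ?ra ?rb.
Qed.

Lemma quotient_hom_image : hom_image F quotient.
Proof.
exists quotient_class; split=> [x|v w|x y /quotient_edgeE[a [b [ab -> ->]]]].
- by have [a ->] := quotient_classE x; exists a.
- exact: quotient_edge.
- by exists a, b.
Qed.

Lemma card_quotient : r != finfun id -> #|quotient| < #|F|.
Proof.
move=> r1; rewrite card_sig ltn_neqAle leq_image_card andbT.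
by apply: contra r1 => /image_injP ri; rewrite -{1}r_ker ker_id_inj; apply/injectiveP=> x y; apply: ri.
Qed.

Lemma card_homs_ker (G : sgraph) :
  #|[set f in homs F G | ker f == r]| = #|embs quotient G|.
Proof.
pose Psi (g : {ffun quotient -> G}) := [ffun x => g (quotient_class x)].
have Psi_inj : injective Psi.
  move=> g g' /ffunP e; apply/ffunP=> x; have [a ->] := quotient_classE x.
  by have := e a; rewrite !ffunE.
rewrite -(card_imset _ Psi_inj); congr #|pred_of_set _|; apply/setP=> f.
rewrite inE; apply/andP/imsetP => [[/homsP hf /eqP kf]|[g /embsP[hg g_inj] ->]].
  have fr x : f (r x) = f x by rewrite -kf ker_val.
  exists [ffun z : quotient => f (val z)]; last by apply/ffunP=> x; rewrite !ffunE fr.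
  apply/embsP; split=> x y.
    by move/quotient_edgeE=> [a [b [ab -> ->]]]; rewrite !ffunE /= !fr; apply: hf.
  have [a ->] := quotient_classE x; have [b ->] := quotient_classE y.
  rewrite !ffunE /= !fr => fab; apply: val_inj => /=.
  by apply/eqP; rewrite -kf ker_eq fab.
split; first by apply/homsP=> x y xy; rewrite !ffunE; apply/hg/quotient_edge.
apply/eqP; transitivity (ker r) => //; apply: ker_ext => x y.
by rewrite !ffunE (inj_eq g_inj) -val_eqE.
Qed.

End Kernel.

Lemma hom_image_refl (F : sgraph) : hom_image F F.
Proof. by exists id; split=> // [x|x y xy]; [exists x | exists x, y]. Qed.

Lemma hom_image_trans (F H K : sgraph) : hom_image F H -> hom_image H K -> hom_image F K.
Proof.
move=> [f [fs fh fe]] [g [gs gh ge]]; exists (g \o f); split.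
- by move=> x; have [y <-] := gs x; have [z <-] := fs y; exists z.
- by move=> v w /fh/gh.
- move=> x y /ge[v [w [/fe[a [b [ab <- <-]]] <- <-]]]; by exists a, b.
Qed.

(** Induction on [#|F|] replaces Moebius inversion over partitions: a nontrivial kernel contributes
    the embeddings of a smaller quotient, whose homomorphic images are again images of [F]. *)
Lemma embs_of_homs (F G G' : sgraph) :
  (forall H, hom_image F H -> #|homs H G| = #|homs H G'|) ->
  #|embs F G| = #|embs F G'|.
Proof.
have [n] := ubnP #|F|; elim: n F => // n IHn F leF homE.
have := homE F (hom_image_refl F).
rewrite (card_fibers (@ker F G)) (card_fibers (@ker F G')).
rewrite (bigD1 (finfun id)) //= [in RHS](bigD1 (finfun id)) //=.
have embE K : [set f in homs F K | ker f == finfun id] = embs F K.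
  by apply/setP=> f; rewrite !inE ker_id_inj.
rewrite !embE (eq_bigr (fun r => #|[set f in homs F G' | ker f == r]|)); first exact: addIn.
move=> r r1.
have zero K : ~ (ker r = r /\ forall a b, a -- b -> r a != r b) ->
    #|[set f in homs F K | ker f == r]| = 0.
  move=> bad; apply/eqP; rewrite cards_eq0; apply/eqP/setP=> f; rewrite in_set0.
  apply/negP; rewrite inE => /andP[/homsP hf /eqP kf]; apply: bad; rewrite -kf ker_idem; split=> // a b ab.
  by rewrite ker_eq; apply: contraTneq (hf _ _ ab) => ->; rewrite sedge_irr.
have [[rk rl]|bad] := pselect (ker r = r /\ forall a b, a -- b -> r a != r b); last by rewrite !zero.
rewrite !card_homs_ker //; apply: IHn; first exact: leq_trans (card_quotient rk r1) _.
by move=> H qH; apply: homE; apply: hom_image_trans qH; apply: quotient_hom_image.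
Qed.

Section SubEmb.
Variables (F G : sgraph).

Definition emb_image (f : {ffun F -> G}) : {set G} * {set {set G}} :=
  ([set f x | x : F], [set e | [exists x, [exists y, (x -- y) && (e == [set f x; f y])]]]).

Definition auts : {set {ffun F -> F}} :=
  [set s : {ffun F -> F} | injectiveb s && [forall x, [forall y, (s x -- s y) == (x -- y)]]].

Lemma emb_imageP (f : {ffun F -> G}) e :
  reflect (exists x y, x -- y /\ e = [set f x; f y]) (e \in (emb_image f).2).
Proof.
rewrite inE; apply: (iffP existsP) => [[x /existsP[y /andP[xy /eqP->]]]|[x [y [xy ->]]]].
  by exists x, y.
by exists x; apply/existsP; exists y; rewrite xy eqxx.
Qed.

Lemma eq_set2 (T : finType) (a b c d : T) : [set a; b] = [set c; d] ->
  (a = c /\ b = d) \/ (a = d /\ b = c).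
Proof.
move=> e; have h x : (x == a) || (x == b) = (x == c) || (x == d).
  by have := congr1 (fun A : {set T} => x \in A) e; rewrite /= !inE.
have := h a; have := h b; have := h c; have := h d; rewrite !eqxx !orbT /=.
move=> /orP[]/eqP-> /orP[]/eqP-> /esym/orP[]/eqP e1 /esym/orP[]/eqP e2; subst; auto.
Qed.

Lemma emb_image_edge (f : {ffun F -> G}) x y : injective f ->
  ([set f x; f y] \in (emb_image f).2) = (x -- y).
Proof.
move=> fi; apply/emb_imageP/idP => [[a [b [ab /eq_set2]]]|xy]; last by exists x, y.
by case=> -[/fi-> /fi->]; rewrite // sedge_sym.
Qed.

Lemma emb_image_sub f : f \in embs F G ->
  is_subgraph (emb_image f) && sg_iso F (subgraph_sgraph (emb_image f)).
Proof.
case/embsP=> hf fi; apply/andP; split.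
  apply/andP; split.
    apply/subsetP=> e /emb_imageP[x [y [/hf xy ->]]]; rewrite inE.
    by apply/existsP; exists (f x); apply/existsP; exists (f y); rewrite xy eqxx.
  apply/forall_inP=> e /emb_imageP[x [y [_ ->]]].
  by apply/subsetP=> v; rewrite !inE => /orP[/eqP->|/eqP->]; apply: imset_f.
have fP x : f x \in (emb_image f).1 by apply: imset_f.
apply/existsP; exists [ffun x => Sub (f x) (fP x)]; apply/and3P; split.
- by apply/injectiveP=> x y; rewrite !ffunE => /(congr1 val) /fi.
- apply/forallP=> -[y yP]; have /imsetP[x _ yE] := yP.
  by apply/codomP; exists x; apply: val_inj; rewrite ffunE.
apply/forallP=> x; apply/forallP=> y; rewrite !ffunE.
rewrite [X in X == _]/(subgraph_rel _ _) /subgraph_rel /= emb_image_edge //.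
by case xy: (x -- y); rewrite ?andbF // hf.
Qed.

Lemma emb_image_onto P : is_subgraph P && sg_iso F (subgraph_sgraph P) ->
  exists2 f, f \in embs F G & emb_image f = P.
Proof.
case/andP=> /andP[/subsetP PE /forall_inP PV] /existsP[g /and3P[/injectiveP gi /forallP gs /forallP ge]].
have gE x y : (val (g x) -- val (g y)) && ([set val (g x); val (g y)] \in P.2) = (x -- y).
  by have /forallP/(_ y)/eqP <- := ge x.
pose f := [ffun x => val (g x)].
exists f.
  apply/embsP; split=> x y; rewrite !ffunE; first by rewrite -gE => /andP[].
  by move/val_inj/gi.
rewrite [RHS]surjective_pairing; congr (_, _); apply/setP=> e.
  apply/imsetP/idP => [[x _ ->]|eP]; first by rewrite ffunE (valP (g x)).
  by have /codomP[x xE] := gs (Sub e eP); exists x; rewrite // ffunE -xE.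
apply/emb_imageP/idP => [[x [y [xy ->]]]|eP].
  by move: xy; rewrite -gE !ffunE => /andP[].
have := PE _ eP; rewrite inE => /existsP[u /existsP[v /andP[uv /eqP eE]]].
have /subsetP eV := PV _ eP.
have uP : u \in P.1 by apply: eV; rewrite eE !inE eqxx.
have vP : v \in P.1 by apply: eV; rewrite eE !inE eqxx orbT.
have /codomP[x xE] := gs (Sub u uP); have /codomP[y yE] := gs (Sub v vP).
have ux : u = f x by rewrite ffunE -xE.
have vy : v = f y by rewrite ffunE -yE.
exists x, y; split; last by rewrite eE ux vy.
by rewrite -gE -xE -yE /= uv -eE eP.
Qed.

(** Embeddings with the same image subgraph differ by composition with an automorphism of [F]. *)
Lemma card_emb_fiber f0 : f0 \in embs F G ->
  #|[set f in embs F G | emb_image f == emb_image f0]| = #|auts|.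
Proof.
case/embsP=> hf0 fi0; pose comp (s : {ffun F -> F}) := [ffun x => f0 (s x)].
have comp_inj : injective comp.
  by move=> s t /ffunP e; apply/ffunP=> x; apply: fi0; have := e x; rewrite !ffunE.
rewrite -(card_imset _ comp_inj); congr #|pred_of_set _|; apply/setP=> f.
rewrite inE; apply/andP/imsetP => [[/embsP[hf fi] /eqP fE]|[s]].
  have /choice[s sE] : forall x, exists y, f0 y = f x.
    move=> x; have : f x \in (emb_image f).1 by apply: imset_f.
    by rewrite fE => /imsetP[y _ ->]; exists y.
  exists (finfun s); last by apply/ffunP=> x; rewrite !ffunE.
  rewrite inE; apply/andP; split.
    by apply/injectiveP=> x y; rewrite !ffunE => e; apply: fi; rewrite -!sE e.
  apply/forallP=> x; apply/forallP=> y; rewrite !ffunE.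
  by rewrite -(emb_image_edge _ _ fi0) !sE -fE emb_image_edge.
rewrite inE => /andP[/injectiveP si /forallP se] ->.
have sE x y : (s x -- s y) = (x -- y) by have /forallP/(_ y)/eqP := se x.
have [t sK tK] : bijective s by apply: injF_bij.
split.
  apply/embsP; split=> x y; rewrite !ffunE; last by move/fi0/si.
  by rewrite -sE => /hf0.
apply/eqP; rewrite [LHS]surjective_pairing [RHS]surjective_pairing; congr (_, _); apply/setP=> e.
  apply/imsetP/imsetP=> -[x _ ->]; first by exists (s x); rewrite ?ffunE.
  by exists (t x); rewrite ?ffunE ?tK.
apply/emb_imageP/emb_imageP=> -[x [y [xy ->]]].
  by exists (s x), (s y); rewrite sE !ffunE.
by exists (t x), (t y); rewrite -sE !ffunE !tK.
Qed.

Lemma card_embs : #|embs F G| = sub F G * #|auts|.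
Proof.
rewrite (card_fibers emb_image) /sub -sum_nat_const.
rewrite [LHS](bigID (fun P => is_subgraph P && sg_iso F (subgraph_sgraph P))) /=.
rewrite [X in _ + X]big1 ?addn0 => [|P notP]; last first.
  apply/eqP; rewrite cards_eq0; apply/eqP/setP=> f; rewrite in_set0.
  apply/negP; rewrite inE => /andP[fE /eqP fP]; by move: notP; rewrite -fP emb_image_sub.
apply: eq_big => [P|P sP]; first by rewrite inE.
by have [f fE <-] := emb_image_onto sP; apply: card_emb_fiber.
Qed.

End SubEmb.

Lemma card_auts_gt0 (F : sgraph) : 0 < #|auts F|.
Proof.
apply/card_gt0P; exists (finfun id); rewrite inE; apply/andP; split.
  by apply/injectiveP=> x y; rewrite !ffunE.
by apply/forallP=> x; apply/forallP=> y; rewrite !ffunE.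
Qed.

(** * Embeddings into cloned graphs *)

Section Blow.
Variables (G : sgraph) (A : {set G}) (t : nat).

Definition blow_vertex := {p : G * 'I_t | p.1 \in A}.
Definition blow_rel : rel blow_vertex := fun p q => (val p).1 -- (val q).1.

Lemma blow_sym : symmetric blow_rel.
Proof. by move=> p q; rewrite /blow_rel sedge_sym. Qed.

Lemma blow_irr : irreflexive blow_rel.
Proof. by move=> p; rewrite /blow_rel sedge_irr. Qed.

Definition blow := SGraph blow_sym blow_irr.
End Blow.

(** Duplicator keeps the clone number and moves the underlying vertex by the original bijection,
    which respects [A] and [A'] since the new pair lies in a winning position. *)
Lemma blow_game k (G G' : sgraph) (P : seq (G * G') -> Prop) (A : {set G}) (A' : {set G'}) t :
  game k P -> (forall s p, P s -> p \in s -> (p.1 \in A) = (p.2 \in A')) ->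
  exists P' : seq (blow A t * blow A' t) -> Prop, game k P'.
Proof.
move=> gP PA; pose proj (p : blow A t * blow A' t) := ((val p.1).1, (val p.2).1).
exists (fun s => P (map proj s) /\ forall p, p \in s -> (val p.1).2 = (val p.2).2).
split=> [|s [Ps cs] sk|s s' [Ps cs] sk ss|s p q [Ps cs] ps qs].
- by split=> //; apply: game_nil gP.
- have [|b [c bK cK] Pb] := game_move gP Ps; first by rewrite size_map.
  have bA x : (b x \in A') = (x \in A) by rewrite -(PA _ (x, b x) (Pb x)) // mem_head.
  have /choice[b' bE] : forall w : blow A t, exists w' : blow A' t,
      val w' = (b (val w).1, (val w).2).
    move=> w; have wA : (b (val w).1, (val w).2).1 \in A' by rewrite bA (valP w).
    by exists (Sub (b (val w).1, (val w).2) wA).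
  have /choice[c' cE] : forall w : blow A' t, exists w' : blow A t,
      val w' = (c (val w).1, (val w).2).
    move=> w; have wA : (c (val w).1, (val w).2).1 \in A by rewrite -bA cK (valP w).
    by exists (Sub (c (val w).1, (val w).2) wA).
  exists b'.
    by exists c' => w; apply: val_inj; rewrite ?cE ?bE ?cE /= ?bK ?cK -surjective_pairing.
  move=> w; split; first by rewrite /= /proj bE; apply: Pb.
  by move=> p; rewrite in_cons => /predU1P[->|/cs //]; rewrite bE.
- split=> [|p /ss]; last exact: cs.
  apply: (game_sub gP Ps); first by rewrite size_map.
  by move=> _ /mapP[p /ss ps ->]; apply: map_f.
- have [||e1 e2] := game_iso (p := proj p) (q := proj q) gP Ps; try exact: map_f.
  split; last exact: e2.
  rewrite -!val_eqE [val p.1]surjective_pairing [val q.1]surjective_pairing.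
  rewrite [val p.2]surjective_pairing [val q.2]surjective_pairing !xpair_eqE.
  by rewrite -(cs p ps) -(cs q qs); congr (_ && _).
Qed.

Import Order.TTheory GRing.Theory Num.Theory.

Section FiberPoly.
Variables (F : finType) (T : eqType) (f : F -> T).

(** At a large [t]: the number of colorings of [s] with [t] colors that are
    injective on each fiber of [f]. *)
Fixpoint fiber_poly (s : seq F) : {poly int} :=
  if s is x :: s' then
    (fiber_poly s' * ('X - (count (fun y => f y == f x) s')%:R%:P))%R
  else 1%R.

(** Each element that is not the last of its fiber contributes a negative
    constant term. *)
Lemma fiber_poly_factor s : exists q : {poly int},
  fiber_poly s = (q * 'X^(size (undup (map f s))))%R /\
  (0 < (-1) ^+ (size s + size (undup (map f s))) * q`_0)%R.
Proof.
elim: s => [|x s [q [E q0]]]; first by exists 1%R; rewrite /= mulr1 expr0 mul1r coef1.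
have cnt : (0 < count (fun y => f y == f x) s) = (f x \in map f s).
  by rewrite -has_count; apply/hasP/mapP => [[y ys /eqP]|[y ys]] e; exists y; rewrite ?e.
have [fx|fx] := boolP (f x \in map f s); last first.
  exists q; rewrite /= (negPf fx) /= addSn addnS !exprS mulN1r mulN1r opprK.
  have -> : count (fun y => f y == f x) s = 0 by apply/eqP; rewrite -leqn0 leqNgt cnt.
  by rewrite subr0 E -mulrA [('X^_ * 'X)%R]mulrC.
rewrite /= fx; exists (q * ('X - (count (fun y => f y == f x) s)%:R%:P))%R; split.
  by rewrite E -!mulrA [('X^_ * _)%R]mulrC.
rewrite coef0M coefB coefX coefC /= sub0r addSn exprS mulN1r mulNr mulrN mulrN opprK mulrA.
by rewrite pmulr_lgt0 // ltr0n cnt.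
Qed.

Lemma fiber_poly_coef s n : n <= size (undup (map f s)) ->
  (0 <= (-1) ^+ (size s + n) * (fiber_poly s)`_n)%R /\
  (0 < (-1) ^+ (size s + n) * (fiber_poly s)`_n)%R = (n == size (undup (map f s))).
Proof.
move=> nd; have [q [-> q0]] := fiber_poly_factor s; rewrite coefMXn.
have [->|nd'] := eqVneq n (size (undup (map f s))).
  by rewrite ltnn subnn q0 ltW.
by rewrite ltn_neqAle nd' nd mulr0 lexx ltxx.
Qed.

Section Colorings.
Variable t : nat.

(** Values off [s] are pinned to [ord0] so that each coloring of [s] is counted once. *)
Definition colorings (s : seq F) : {set {ffun F -> 'I_t.+1}} :=
  [set c : {ffun F -> 'I_t.+1} | [forall x, (x \notin s) ==> (c x == ord0)]
    && [forall x, [forall y, [&& x \in s, y \in s, f x == f y & c x == c y] ==> (x == y)]]].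

Lemma coloringsP s (c : {ffun F -> 'I_t.+1}) :
  reflect ((forall x, x \notin s -> c x = ord0) /\
           (forall x y, x \in s -> y \in s -> f x = f y -> c x = c y -> x = y))
          (c \in colorings s).
Proof.
rewrite inE; apply: (iffP andP) => -[h1 h2]; split.
- by move=> x xs; apply/eqP; have /forallP/(_ x)/implyP := h1; apply.
- move=> x y xs ys fxy cxy; have /forallP/(_ x)/forallP/(_ y)/implyP := h2.
  by rewrite xs ys fxy cxy !eqxx => /(_ isT)/eqP.
- by apply/forallP=> x; apply/implyP=> /h1/eqP.
- apply/forallP=> x; apply/forallP=> y; apply/implyP=> /and4P[xs ys /eqP fxy /eqP cxy].
  by apply/eqP; apply: h2.
Qed.

(** The new element may take any color but those on its fiber in [s], which are pairwise
    distinct. *)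
Lemma card_colorings_cons x s : x \notin s -> uniq s ->
  #|colorings (x :: s)| = #|colorings s| * (t.+1 - count (fun y => f y == f x) s).
Proof.
move=> xs us; pose reset (c : {ffun F -> 'I_t.+1}) := [ffun y => if y == x then ord0 else c y].
have xy y : y \in s -> (y == x) = false by move=> ys; apply: contraTF ys => /eqP->.
rewrite (card_fibers reset) -sum_nat_const [LHS](bigID (mem (colorings s))) /=.
rewrite [X in _ + X]big1 ?addn0 => [|b bs]; last first.
  apply/eqP; rewrite cards_eq0; apply/eqP/setP=> c; rewrite in_set0; apply/negP.
  rewrite inE => /andP[/coloringsP[c0 ci] /eqP bE]; case/negP: bs; rewrite -bE.
  apply/coloringsP; split=> [y ys|y z ys zs]; rewrite !ffunE.
    by case: eqP => // /eqP yx; apply: c0; rewrite in_cons negb_or yx.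
  by rewrite !xy //; apply: ci; rewrite in_cons ?ys ?zs orbT.
apply: eq_bigr => b /coloringsP[b0 bi].
pose used := [set b y | y in [set y in s | f y == f x]].
have cu : #|used| = count (fun y => f y == f x) s.
  rewrite card_in_imset => [|y z]; last first.
    by rewrite !inE => /andP[ys /eqP fy] /andP[zs /eqP fz]; apply: bi; rewrite // fy fz.
  rewrite -size_filter -(card_uniqP (filter_uniq _ us)); apply: eq_card => y.
  by rewrite inE mem_filter andbC.
have -> : t.+1 - count (fun y => f y == f x) s = #|~: used|.
  by rewrite -cu [in RHS]cardsCs setCK card_ord.
pose put a := [ffun y => if y == x then a else b y] : {ffun F -> 'I_t.+1}.
have put_inj : injective put by move=> a a' /ffunP/(_ x); rewrite !ffunE eqxx.
rewrite -(card_imset _ put_inj); congr #|pred_of_set _|; apply/setP=> c.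
rewrite inE; apply/andP/imsetP => [[/coloringsP[c0 ci] /eqP bE]|[a]].
  exists (c x); last by apply/ffunP=> y; rewrite /put -bE !ffunE; case: eqP => [->|].
  rewrite inE; apply/negP=> /imsetP[y]; rewrite !inE => /andP[ys /eqP fy].
  rewrite -bE ffunE xy // => cxy; have := xy y ys.
  by rewrite (ci y x) ?eqxx // ?in_cons ?ys ?eqxx ?orbT.
rewrite inE => aU ->; split; last first.
  apply/eqP/ffunP=> y; rewrite !ffunE; case: (eqVneq y x) => // ->.
  by rewrite b0.
have ab y : y \in s -> f y = f x -> a <> b y.
  by move=> ys fy e; case/negP: aU; rewrite e; apply: imset_f; rewrite inE ys fy eqxx.
apply/coloringsP; split=> [y|y z].
  by rewrite in_cons negb_or ffunE => /andP[/negPf-> /b0].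
rewrite !in_cons !ffunE.
case: (eqVneq y x) => [->|yx] /= ys; case: (eqVneq z x) => [->|zx] //= zs fyz.
- by move/(ab _ zs (esym fyz)).
- by move/esym/(ab _ ys fyz).
- exact: bi.
Qed.

Lemma card_colorings s : uniq s -> size s <= t.+1 ->
  ((#|colorings s|)%:R = (fiber_poly s).[(t.+1)%:R])%R.
Proof.
elim: s => [|x s IHs] /=.
  move=> _ _; rewrite hornerC (_ : colorings [::] = [set [ffun _ => ord0]]) ?cards1 //.
  apply/setP=> c; rewrite in_set1; apply/coloringsP/eqP => [[c0 _]|->].
    by apply/ffunP=> x; rewrite ffunE c0.
  by split=> // x _; rewrite ffunE.
move=> /andP[xs us] st; rewrite card_colorings_cons // natrM IHs //; last exact: ltnW.
(* The bound on [size s] keeps the truncated subtraction exact. *)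
rewrite hornerM hornerXsubC natrB //.
by apply: leq_trans (count_size _ _) _; apply: ltnW.
Qed.

End Colorings.
End FiberPoly.

Lemma eq_fiber_poly (F : finType) (T T' : eqType) (f : F -> T) (g : F -> T') s :
  (forall x y, (f x == f y) = (g x == g y)) -> fiber_poly f s = fiber_poly g s.
Proof.
move=> fg; elim: s => //= x s ->; congr (_ * ('X - _%:R%:P))%R.
by apply: eq_count => y; apply: fg.
Qed.

(** An embedding is a homomorphism [f] into the base together with clone numbers; it is injective
    exactly when these are injective on the fibers of [f]. *)
Lemma card_embs_blow (F G : sgraph) (A : {set G}) t : #|F| <= t.+1 ->
  ((#|embs F (blow A t.+1)|)%:R =
   \sum_(f in homs F G | [forall x, f x \in A]) (fiber_poly f (enum F)).[(t.+1)%:R])%R.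
Proof.
move=> Ft; pose h (g : {ffun F -> blow A t.+1}) : {ffun F -> G} := [ffun x => (val (g x)).1].
rewrite (card_fibers h) natr_sum [LHS](bigID (fun f => (f \in homs F G) && [forall x, f x \in A])) /=.
rewrite [X in (_ + X)%R]big1 ?addr0 => [|f bad]; last first.
  rewrite (_ : [set g in embs F (blow A t.+1) | h g == f] = set0) ?cards0 //; apply/setP=> g; rewrite in_set0.
  apply/negP; rewrite inE => /andP[/(@embsP F (blow A t.+1) g)[hg _] /eqP gf]; case/negP: bad; rewrite -gf.
  apply/andP; split; last by apply/forallP=> x; rewrite ffunE; apply: (valP (g x)).
  by apply/homsP=> x y /hg; rewrite !ffunE.
apply: eq_bigr => f /andP[/homsP hf /forallP fA].
rewrite -card_colorings ?enum_uniq // -?cardE //; congr (_%:R)%R.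
pose lift (c : {ffun F -> 'I_t.+1}) : {ffun F -> blow A t.+1} :=
  [ffun x => Sub (f x, c x) (fA x : (f x, c x).1 \in A)].
have lift_inj : injective lift.
  move=> c c' /ffunP e; apply/ffunP=> x; have := e x; rewrite !ffunE.
  by move/(congr1 val) => /= -[].
rewrite -(card_imset _ lift_inj); congr #|pred_of_set _|; apply/setP=> g.
rewrite inE; apply/andP/imsetP => [[/(@embsP F (blow A t.+1) g)[hg gi] /eqP gf]|[c /coloringsP[_ ci] ->]].
  exists [ffun x => (val (g x)).2]; last first.
    apply/ffunP=> x; apply: val_inj; rewrite !ffunE /= -gf ffunE.
    exact: surjective_pairing.
  apply/coloringsP; split=> [x|x y _ _]; first by rewrite mem_enum.
  rewrite -gf !ffunE => e1 e2; apply: gi; apply: val_inj.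
  by rewrite [LHS]surjective_pairing [RHS]surjective_pairing e1 e2.
split; last by apply/eqP/ffunP=> x; rewrite !ffunE.
apply/(@embsP F (blow A t.+1) (lift c)); split=> x y; rewrite !ffunE; first exact: hf.
by move/(congr1 val) => /= -[fxy cxy]; apply: ci; rewrite ?mem_enum.
Qed.

Lemma poly_eq_on_large (p q : {poly int}) (n : nat) :
  (forall t : nat, n <= t -> p.[t%:R]%R = q.[t%:R]%R) -> p = q.
Proof.
move=> pq; apply/eqP; rewrite -subr_eq0; apply/eqP.
apply: (@roots_geq_poly_eq0 _ _ [seq (i%:R : int)%R | i <- iota n (size (p - q)%R)]).
- apply/allP=> x /mapP[i]; rewrite mem_iota => /andP[ni _] ->.
  by rewrite rootE hornerD hornerN pq // subrr.
- rewrite map_inj_uniq ?iota_uniq // => i j /eqP; by rewrite eqr_nat => /eqP.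
- by rewrite size_map size_iota.
Qed.

(** * The leading transversal term *)

(** Handshake: every edge label is counted at both of its ends. *)
Lemma parity_sum_symmetric (H : sgraph) (S : H -> {ffun H -> bool}) :
  symmetric_labels S -> \big[addb/false]_v parity v (S v) = false.
Proof.
move=> symS; pose a (v u : H) := (v -- u) && S v u.
have aC v u : a v u = a u v.
  by rewrite /a sedge_sym; case uv: (u -- v) => //=; rewrite (symS u v).
(* Ranks orient each edge, so that its two occurrences can be paired. *)
pose b (v u : H) := a v u && (enum_rank v < enum_rank u).
have -> : \big[addb/false]_v parity v (S v) = \big[addb/false]_v \big[addb/false]_u (b v u (+) b u v).
  apply: eq_bigr => v _; rewrite /parity big_mkcond; apply: eq_bigr => u _.
  rewrite /b [a u v]aC /a; case vu: (v -- u) => //=; case: (S v u) => //=.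
  have : enum_rank v != enum_rank u :> nat.
    by rewrite (inj_eq val_inj) (inj_eq enum_rank_inj); apply: contraTneq vu => ->; rewrite sedge_irr.
  by case: ltngtP.
under eq_bigr do rewrite big_split.
by rewrite big_split /= [X in _ (+) X]exchange_big /= addbb.
Qed.

Lemma uniq_map_inj (T1 T2 : eqType) (h : T1 -> T2) s :
  uniq (map h s) -> {in s &, injective h}.
Proof.
elim: s => // x s IHs /= /andP[hx us] y z; rewrite !in_cons.
move=> /predU1P[->|ys] /predU1P[->|zs] // e; last exact: IHs.
  by case/negP: hx; rewrite e map_f.
by case/negP: hx; rewrite -e map_f.
Qed.

Section Transversals.
Variables F H : sgraph.

Definition base_map (U : {set H}) (f : {ffun F -> cfi U}) : {ffun F -> H} := [ffun x => cfi_base (f x)].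

Definition transversals (U : {set H}) (g : {ffun F -> H}) : {set {ffun F -> cfi U}} :=
  [set f in homs F (cfi U) | (base_map f == g) && [forall x, [forall y, (g x == g y) ==> (f x == f y)]]].

Lemma transversalsP U (g : {ffun F -> H}) (f : {ffun F -> cfi U}) :
  reflect [/\ forall x y, x -- y -> f x -- f y, forall x, cfi_base (f x) = g x
             & forall x y, g x = g y -> f x = f y]
          (f \in transversals U g).
Proof.
rewrite inE; apply: (iffP and3P) => [[/homsP hf /eqP fg /forallP fi]|[hf fg fi]].
  split=> // [x|x y gxy]; first by rewrite -fg ffunE.
  by have /forallP/(_ y)/implyP := fi x; rewrite gxy eqxx => /(_ isT)/eqP.
split; first exact/homsP.
  by apply/eqP/ffunP=> x; rewrite ffunE.
by apply/forallP=> x; apply/forallP=> y; apply/implyP=> /eqP/fi/eqP.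
Qed.

(** Xor with one lift into the twisted graph maps all of them injectively into
    the untwisted one. *)
Lemma leq_transversals u0 (g : {ffun F -> H}) : #|transversals [set u0] g| <= #|transversals set0 g|.
Proof.
have [->|/set0Pn[f1 /transversalsP[hf1 bf1 tf1]]] := eqVneq (transversals [set u0] g) set0.
  by rewrite cards0.
have sumP (p q : cfi [set u0]) :
    parity (val p).1 (if (val p).1 == (val q).1 then xor_labels (val p).2 (val q).2 else label0 H)
      == ((val p).1 \in set0).
  rewrite inE; case: (eqVneq (val p).1 (val q).1) => [e|_]; last by rewrite parity0.
  have /eqP pP := valP p; have /eqP qP := valP q.
  by rewrite parity_xor pP e qP addbb.
pose sum p q : cfi set0 := Sub ((val p).1, _) (sumP p q).
have sumE p q : cfi_base p = cfi_base q -> val (sum p q) = ((val p).1, xor_labels (val p).2 (val q).2).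
  by rewrite /cfi_base /= => ->; rewrite eqxx.
pose shift (f : {ffun F -> cfi [set u0]}) : {ffun F -> cfi set0} := [ffun x => sum (f x) (f1 x)].
rewrite -(card_in_imset (f := shift)); last first.
  move=> f f' /transversalsP[_ bf _] /transversalsP[_ bf' _] /ffunP e; apply/ffunP=> x.
  have := congr1 val (e x); rewrite !ffunE !sumE ?bf ?bf1 ?bf' // => -[ev exor].
  apply: val_inj; rewrite [LHS]surjective_pairing [RHS]surjective_pairing ev; congr (_, _).
  exact: can_inj (xor_labelsK (val (f1 x)).2) _ _ exor.
apply: subset_leq_card; apply/subsetP=> _ /imsetP[f /transversalsP[hf bf tf] ->].
have shiftE x : val (shift f x) = ((val (f x)).1, xor_labels (val (f x)).2 (val (f1 x)).2).
  by rewrite ffunE sumE // bf bf1.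
apply/transversalsP; split=> [x y xy|x|x y gxy].
- have /andP[xy1 /eqP e] := hf x y xy; have /andP[_ /eqP e1] := hf1 x y xy.
  apply/andP; rewrite !shiftE /= !ffunE e; split=> //.
  have -> : (val (f x)).1 = (val (f1 x)).1 by rewrite -!/(cfi_base _) bf bf1.
  have -> : (val (f y)).1 = (val (f1 y)).1 by rewrite -!/(cfi_base _) bf bf1.
  by rewrite e1.
- by rewrite /cfi_base shiftE -bf.
- by apply: val_inj; rewrite !shiftE (tf _ _ gxy) (tf1 _ _ gxy).
Qed.

Section EdgeSurjective.
Variable g : {ffun F -> H}.
Hypothesis g_hom : forall x y, x -- y -> g x -- g y.
Hypothesis g_surj : forall v, exists x, g x = v.
Hypothesis g_edge : forall v w, v -- w -> exists x y, [/\ x -- y, g x = v & g y = w].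

Lemma transversals_untwisted : 0 < #|transversals set0 g|.
Proof.
have zP v : parity (v, label0 H).1 (v, label0 H).2 == (v \in set0) by rewrite parity0 inE.
apply/card_gt0P; exists [ffun x => Sub (g x, label0 H) (zP (g x)) : cfi set0].
apply/transversalsP; split=> [x y xy|x|x y gxy]; rewrite !ffunE.
- by apply/andP; rewrite /= !ffunE g_hom.
- by [].
- by apply: val_inj; rewrite /= gxy.
Qed.

(** As [g] reaches every edge, a transversal lift would give one consistent label per edge of [H];
    the parities then sum to even, whereas a single twist requires odd. *)
Lemma transversals_twisted u0 : #|transversals [set u0] g| = 0.
Proof.
apply/eqP; rewrite cards_eq0; apply/eqP/setP=> f; rewrite in_set0; apply/negP.
case/transversalsP=> hf bf tf.
have /choice[pre preE] := g_surj.
pose S v := (val (f (pre v))).2.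
have SE x : S (g x) = (val (f x)).2 by rewrite /S (tf _ x).
have symS : symmetric_labels S.
  move=> v w /g_edge[x [y [xy <- <-]]]; rewrite !SE.
  by have /andP[_ /eqP] := hf _ _ xy; rewrite -!/(cfi_base _) !bf.
have := parity_sum_symmetric symS.
have parE v : parity v (S v) = (v == u0).
  have /eqP := valP (f (pre v)); rewrite -/(cfi_base _) bf preE /S => ->.
  by rewrite inE.
rewrite (bigD1 u0) //= parE eqxx big1 // => v /negPf vu.
by rewrite parE vu.
Qed.

End EdgeSurjective.

Definition base_set (W : {set H}) U : {set cfi U} := [set p | cfi_base p \in W].

Lemma cfi_sub_difference u0 : hom_image F H ->
  ~ forall (W : {set H}) t, #|embs F (blow (base_set W set0) t)| =
                            #|embs F (blow (base_set W [set u0]) t)|.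
Proof.
move=> [g0 [g0s g0h g0e]] eqE.
pose fp (T : eqType) (f : F -> T) := fiber_poly f (enum F).
pose Q (U W : {set H}) : {poly int} := (\sum_(f in homs F (cfi U) | [forall x, f x \in base_set W U]) fp _ f)%R.
pose img (U : {set H}) (f : {ffun F -> cfi U}) : {set H} := [set cfi_base (f x) | x : F].
pose R (U W : {set H}) : {poly int} := (\sum_(f in homs F (cfi U) | img U f == W) fp _ f)%R.
(* The polynomials take equal values, the numbers of embeddings, at all large [t]. *)
have eqQ W : Q set0 W = Q [set u0] W.
  apply: (@poly_eq_on_large _ _ #|F|.+1) => -[//|t] Ft.
  rewrite !horner_sum -!card_embs_blow ?eqE //; exact: ltnW.
have QE U W : Q U W = (\sum_(W' : {set H} | W' \subset W) R U W')%R.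
  rewrite /Q (partition_big (img U) (fun W' : {set H} => W' \subset W)) /=.
    apply: eq_bigr => W' WW'; apply: eq_bigl => f; rewrite -andbA; congr (_ && _).
    case: eqP => [e|]; rewrite ?andbT ?andbF //.
    apply/forallP=> x; rewrite inE; apply: (subsetP WW'); rewrite -e; exact: imset_f.
  move=> f /andP[_ /forallP fW]; apply/subsetP=> _ /imsetP[x _ ->].
  by have := fW x; rewrite inE.
(* Inclusion-exclusion by induction on [#|W|]: the contributions of smaller base images cancel. *)
have eqR W : R set0 W = R [set u0] W.
  have [n] := ubnP #|W|; elim: n W => // n IHn W Wn.
  have := eqQ W; rewrite !QE (bigD1 W) //= [in RHS](bigD1 W) //=.
  rewrite [X in (_ + X)%R](eq_bigr (R [set u0])); first exact: addIr.
  move=> W' /andP[W'W W'ne]; apply: IHn; rewrite ltnS in Wn; apply: leq_trans Wn.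
  by apply: proper_card; rewrite properEneq W'ne.
(* [sgn] is the sign of the coefficient of degree [n] for a map with exactly [n] values. *)
pose n := #|H|; pose sgn := ((-1) ^+ (#|F| + n) : int)%R.
pose w (g : {ffun F -> H}) := (sgn * (fp _ g)`_n)%R.
pose surj (g : {ffun F -> H}) := [forall v, v \in codom g].
have size_surj g : surj g -> size (undup (map g (enum F))) = n.
  move=> /forallP gs; rewrite -(card_uniqP (undup_uniq _)) /n; apply: eq_card => v.
  by rewrite mem_undup inE; have := gs v; rewrite codomE enumT.
have w_gt0 g : surj g -> (0 < w g)%R.
  move=> gs; have [|_] := @fiber_poly_coef _ _ g (enum F) n; rewrite size_surj //.
  by rewrite eqxx -cardE => ->.
have coefR U : (sgn * (R U [set: H])`_n = \sum_(g | surj g) w g * (#|transversals U g|)%:R)%R.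
  rewrite /R coef_sum mulr_sumr.
  rewrite (partition_big (@base_map U) surj) /=; last first.
    move=> f /andP[_ /eqP fH]; apply/forallP=> v.
    have /imsetP[x _ ->] : v \in img U f by rewrite fH inE.
    by rewrite -[cfi_base _](ffunE (fun x => cfi_base (f x))) codom_f.
  apply: eq_bigr => g gs; rewrite mulr_natr -sumr_const.
  rewrite [LHS](bigID (mem (transversals U g))) /= [X in (_ + X)%R]big1 ?addr0.
    apply: eq_big => [f|f /andP[_ /transversalsP[_ bf tf]]].
      apply/andP/idP => [[_ //]|/[dup] fT /transversalsP[hf bf tf]]; split=> //.
      apply/andP; split; last by apply/eqP/ffunP=> x; rewrite ffunE bf.
      apply/andP; split; first exact/(@homsP F (cfi U) f).
      apply/eqP/setP=> v; rewrite inE; apply/imsetP.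
      by have /codomP[x ->] := forallP gs v; exists x.
    rewrite /w /fp (@eq_fiber_poly _ _ _ f g) // => x y.
    by apply/eqP/eqP => [e|/tf //]; rewrite -!bf e.
  move=> f /andP[/andP[/andP[/(@homsP F (cfi U) f) hf /eqP fH] /eqP fg] fT].
  have bf x : cfi_base (f x) = g x by rewrite -fg ffunE.
  (* A map onto [V(H)] with only [n] values has one over each base vertex and is a transversal; any
     other has more values, so its polynomial has no term of degree [n]. *)
  have nle : n < size (undup (map f (enum F))).
    pose s := undup (map f (enum F)).
    have gE : [set: H] = [set v in map (@cfi_base H U) s].
      apply/setP=> v; rewrite !inE; have /codomP[x ->] := forallP gs v.
      by apply/esym/mapP; exists (f x); rewrite ?bf // mem_undup map_f // mem_enum.
    have sn : n <= size s by rewrite -(size_map (@cfi_base H U)) /n -cardsT gE cardsE card_size.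
    rewrite ltn_neqAle sn andbT; apply: contra fT => /eqP ns.
    have /uniq_map_inj inj_s : uniq (map (@cfi_base H U) s).
      by apply/card_uniqP; rewrite size_map -/s -ns /n -cardsT gE cardsE.
    apply/transversalsP; split=> // x y gxy; apply: inj_s; rewrite ?bf //;
      by rewrite mem_undup map_f // mem_enum.
  by rewrite /fp; have [q [-> _]] := fiber_poly_factor f (enum F); rewrite coefMXn nle mulr0.
have sumR : (\sum_(g | surj g) w g * (#|transversals set0 g|)%:R =
             \sum_(g | surj g) w g * (#|transversals [set u0] g|)%:R)%R.
  by rewrite -!coefR eqR.
pose g := [ffun x => g0 x].
have gs v : exists x, g x = v by have [x <-] := g0s v; exists x; rewrite ffunE.
have surj_g : surj g by apply/forallP=> v; have [x <-] := gs v; apply: codom_f.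
have n0 : 0 < #|transversals set0 g|.
  by apply: transversals_untwisted => x y xy; rewrite !ffunE; apply: g0h.
have n1 : #|transversals [set u0] g| = 0.
  apply: transversals_twisted => // v v' /g0e[x [y [xy <- <-]]].
  by exists x, y; rewrite !ffunE.
(* The termwise differences are nonnegative with sum zero, so each vanishes, yet the one at [g] is
   positive. *)
move/eqP: sumR; rewrite -subr_eq0 -sumrB => /eqP/psumr_eq0P sum0.
have /sum0/(_ g surj_g)/eqP : forall h, surj h ->
    (0 <= w h * (#|transversals set0 h|)%:R - w h * (#|transversals [set u0] h|)%:R)%R.
  move=> h hs; rewrite -mulrBr mulr_ge0 ?(ltW (w_gt0 _ hs)) // subr_ge0 ler_nat.
  exact: leq_transversals.
by rewrite n1 mulr0 subr0 mulf_eq0 (gt_eqF (w_gt0 _ surj_g)) pnatr_eq0 -leqn0 leqNgt n0.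
Qed.

End Transversals.

(** * The two implications *)

Lemma wl_equiv_leq_homs k (G G' F : sgraph) (P : seq (G * G') -> Prop) :
  game k P -> treewidth F <= k -> #|homs F G| <= #|homs F G'|.
Proof.
move=> gP twF; have [L [vL LF cover edge]] := treewidth_valid F.
apply: game_leq_homs gP vL _ cover edge.
by apply/allP=> b /(allP LF) bF; apply: leq_trans bF _.
Qed.

Lemma wl_invariant_sub (F : sgraph) k : 0 < k -> htw F <= k -> wl_invariant k (sub F).
Proof.
move=> k0; rewrite /htw; case: ex_maxnP => m _ maxm mk G G' eqG.
have gP := wl_equiv_game eqG k0.
apply/eqP; rewrite -(eqn_pmul2r (card_auts_gt0 F)) -!card_embs; apply/eqP.
apply: embs_of_homs => H FH.
have twH : treewidth H <= k.
  by apply: leq_trans mk; apply: maxm; apply/asboolP; exists H.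
apply/eqP; rewrite eqn_leq (wl_equiv_leq_homs gP twH).
exact: wl_equiv_leq_homs (game_sym gP) twH.
Qed.

Lemma sub_not_wl_invariant (F H : sgraph) k : 0 < k -> hom_image F H ->
  k < treewidth H -> ~ wl_invariant k (sub F).
Proof.
move=> k0 FH twH inv.
have [beta [b_ex b_notin b_conn b_sub]] := haven_exists k0 twH.
have [|u0 b_u0] := b_ex set0; first by rewrite cards0.
have gP := cfi_game b_ex b_notin b_conn b_sub b_u0.
apply: (@cfi_sub_difference F H u0) => // W t.
rewrite !card_embs; congr (_ * _); apply: inv.
have [|P' gP'] := @blow_game _ _ _ _ (base_set W set0) (base_set W [set u0]) t gP.
  by move=> s p ws ps; rewrite !inE (cfi_winning_base ws ps).
exact: game_wl_equiv gP'.
Qed.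

Theorem theorem1p3 (F : sgraph) (k : nat) (hk : 1 <= k) :
  wl_invariant k (sub F) <-> htw F <= k.
Proof.
split=> [inv|]; last exact: wl_invariant_sub.
rewrite leqNgt; apply/negP; rewrite /htw; case: ex_maxnP => m /asboolP[H [FH <-]] _ twH.
exact: sub_not_wl_invariant hk FH twH inv.
Qed.
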